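(* Let $f:\mathbb{R}^n\to\mathbb{R}$ be convex and twice continuously differentiable, let $A\in\mathbb{R}^{m\times n}$ have full row rank $m$, let $b\in\mathbb{R}^m$, $0\le s\le n$, $\tfrac12\le\gamma<1$, $t_0\ge 0$, $\sigma_1>0$, $\sigma_2>0$, and assume that the problem (P) $\min\{f(x): Ax=b,\ x_i\ge 0,\ i=1,\dots,s\}$ has an optimal solution. Let $(x^0,y^0)\in\mathbb{R}^n_{s++}\times\mathbb{R}^m$ and let $(x(t),y(t))$, $t\in[t_0,+\infty)$, be the solution of the ODE system $$\frac{dx}{dt}=-U(x)^2\left[\nabla f(x)+A^Ty+\sigma_1A^T(Ax-b)\right],\quad x(t_0)=x^0,\qquad \frac{dy}{dt}=\sigma_2(Ax-b),\quad y(t_0)=y^0 .$$ Then the following hold. (a) For any $(x^{(1)},y^{(1)})\in\Omega^1(x^0,y^0)$, any $(x^{(2)},y^{(2)})\in\Omega^1(x^0,y^0)$, and any optimal solution $(\tilde y,\tilde z)$ of the dual problem (D), $\|y^{(1)}-\tilde y\|=\|y^{(2)}-\tilde y\|$. (b) As $t\to+\infty$, $x(t)$ converges to an optimal solution of (P) which has the maximal number of positive components among the coordinates $x_1,\dots,x_s$ among all optimal solutions of (P). (c) If there exists a pair of primal and dual optimal solutions (of (P) and (D) respectively) satisfying strict complementarity, then $(y(t),z(t)_S)$ converges, as $t\to+\infty$, to an optimal solution of (D).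
   Context: Notation: $\mathbb{R}^n_{s++}=\{x\in\mathbb{R}^n: x_i>0,\ 1\le i\le s\}$. For $x\in\mathbb{R}^n_{s++}$, $U(x)=\mathrm{diag}(u)\in\mathbb{R}^{n\times n}$ with $u_i=x_i^{\gamma}$ for $1\le i\le s$ and $u_i=1$ for $s+1\le i\le n$. $\|\cdot\|$ is the Euclidean norm. The ODE system is considered on $\mathbb{R}^n_{s++}\times\mathbb{R}^m$; its solution exists, is unique, and is defined on all of $[t_0,+\infty)$. Dual problem (D): $\max\{L(y,z): y\in\mathbb{R}^m,\ z\in\mathbb{R}^s,\ z\ge 0\}$, where $L(y,z)=\inf_{x\in\mathbb{R}^n}\left[f(x)+y^T(Ax-b)-\sum_{i=1}^s x_iz_i\right]$. Limit set: $\Omega^1(x^0,y^0)$ is the set of $(p_1,p_2)\in\mathbb{R}^n\times\mathbb{R}^m$ for which there is a sequence $t_k\to+\infty$ with $(x(t_k),y(t_k))\to(p_1,p_2)$. $z(t)=\nabla f(x(t))+A^Ty(t)+\sigma_1A^T(Ax(t)-b)\in\mathbb{R}^n$, $S=\{1,\dots,s\}$, and $z(t)_S\in\mathbb{R}^s$ is the vector of components of $z(t)$ indexed by $S$. Strict complementarity of an optimal solution $x^*$ of (P) and an optimal solution $(y^*,z^* )$ of (D) means: for every $i\in S$, $x_i^*z_i^*=0$ and $x_i^*+z_i^*>0$ (i.e. $z_i^*>0$ whenever $x_i^*=0$). *)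

(* Defs.v *)
From HB Require Import structures.
From mathcomp Require Import all_boot all_order all_algebra.
From mathcomp Require Import all_classical all_reals all_analysis.
Set Implicit Arguments.
Unset Strict Implicit.
Unset Printing Implicit Defensive.
Import Order.TTheory GRing.Theory Num.Theory.
Import numFieldNormedType.Exports.
Local Open Scope classical_set_scope.
Local Open Scope ring_scope.

(* Vectors of R^n are columns 'cV[R]_n; their library norm is the sup norm,
   which induces the same topology as the Euclidean norm below. The index set
   S = {1, ..., s} is 'I_s, embedded in 'I_n by widen_ord le_sn. *)

Definition euclidean_norm (R : realType) (n : nat) (v : 'cV[R]_n) : R :=
  Num.sqrt (\sum_(i < n) v i 0 ^+ 2).

Definition gradient (R : realType) (n : nat) (f : 'cV[R]_n -> R)
    (x : 'cV[R]_n) : 'cV[R]_n :=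
  \col_(i < n) 'D_(delta_mx i 0) f x.

Definition hessian (R : realType) (n : nat) (f : 'cV[R]_n -> R)
    (x : 'cV[R]_n) : 'M[R]_n :=
  \matrix_(i < n, j < n)
    'D_(delta_mx j 0) (fun x' : 'cV[R]_n => gradient f x' i 0) x.

Definition twice_continuously_differentiable (R : realType) (n : nat)
    (f : 'cV[R]_n -> R) : Prop :=
  [/\ forall x, differentiable f x,
      forall x, differentiable (gradient f) x
    & continuous (hessian f)].

(* One-sided when t is an endpoint of the interval D. *)
Definition is_derivative_in (R : realType) (V : normedModType R)
    (D : set R) (u : R -> V) (t : R) (l : V) : Prop :=
  (r - t)^-1 *: (u r - u t) @[r --> within D t^'] --> l.

Definition pos_orthant (R : realType) (n s : nat) : set 'cV[R]_n :=
  [set x | forall i : 'I_n, (i < s)%N -> 0 < x i 0].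
Arguments pos_orthant : clear implicits.

Definition scaling_mx (R : realType) (n s : nat) (gamma : R)
    (x : 'cV[R]_n) : 'M[R]_n :=
  diag_mx (\row_(i < n) if (i < s)%N then x i 0 `^ gamma else 1).

Definition primal_feasible (R : realType) (m n s : nat)
    (A : 'M[R]_(m, n)) (b : 'cV[R]_m) : set 'cV[R]_n :=
  [set x | A *m x = b /\ forall i : 'I_n, (i < s)%N -> 0 <= x i 0].

Definition primal_optimal (R : realType) (m n s : nat) (f : 'cV[R]_n -> R)
    (A : 'M[R]_(m, n)) (b : 'cV[R]_m) : set 'cV[R]_n :=
  [set x | primal_feasible s A b x /\
           forall x', primal_feasible s A b x' -> f x <= f x'].

(* Takes the value -oo when the infimum is not finite. *)
Definition dual_function (R : realType) (m n s : nat) (le_sn : (s <= n)%N)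
    (f : 'cV[R]_n -> R) (A : 'M[R]_(m, n)) (b : 'cV[R]_m)
    (y : 'cV[R]_m) (z : 'cV[R]_s) : \bar R :=
  ereal_inf [set (f x + (y^T *m (A *m x - b)) 0 0
                  - \sum_(i < s) x (widen_ord le_sn i) 0 * z i 0)%:E
            | x in [set: 'cV[R]_n]].

Definition dual_feasible (R : realType) (m s : nat) :
    set ('cV[R]_m * 'cV[R]_s) :=
  [set d : 'cV[R]_m * 'cV[R]_s | forall i : 'I_s, 0 <= d.2 i 0].
Arguments dual_feasible : clear implicits.

Definition dual_optimal (R : realType) (m n s : nat) (le_sn : (s <= n)%N)
    (f : 'cV[R]_n -> R) (A : 'M[R]_(m, n)) (b : 'cV[R]_m) :
    set ('cV[R]_m * 'cV[R]_s) :=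
  [set d : 'cV[R]_m * 'cV[R]_s | dual_feasible R m s d /\
           forall d', dual_feasible R m s d' ->
             (dual_function le_sn f A b d'.1 d'.2
              <= dual_function le_sn f A b d.1 d.2)%E].

(* grad_x of the augmented Lagrangian: the z(t) of the dual trajectory when
   evaluated at (x(t), y(t)). *)
Definition aug_gradient (R : realType) (m n : nat) (f : 'cV[R]_n -> R)
    (A : 'M[R]_(m, n)) (b : 'cV[R]_m) (sigma1 : R)
    (x : 'cV[R]_n) (y : 'cV[R]_m) : 'cV[R]_n :=
  gradient f x + A^T *m y + sigma1 *: (A^T *m (A *m x - b)).

Definition ode_solution (R : realType) (m n s : nat) (f : 'cV[R]_n -> R)
    (A : 'M[R]_(m, n)) (b : 'cV[R]_m) (gamma t0 sigma1 sigma2 : R)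
    (x0 : 'cV[R]_n) (y0 : 'cV[R]_m)
    (x : R -> 'cV[R]_n) (y : R -> 'cV[R]_m) : Prop :=
  [/\ x t0 = x0, y t0 = y0
    & forall t, t0 <= t ->
      [/\ pos_orthant R n s (x t),
          is_derivative_in `[t0, +oo[ x t
            (- (scaling_mx s gamma (x t) ^+ 2
                *m aug_gradient f A b sigma1 (x t) (y t)))
        & is_derivative_in `[t0, +oo[ y t (sigma2 *: (A *m x t - b))]].

(* Omega^1(x0, y0), for the trajectory (x, y) started from (x0, y0) at t0. *)
Definition limit_set (R : realType) (m n : nat) (t0 : R)
    (x : R -> 'cV[R]_n) (y : R -> 'cV[R]_m) : set ('cV[R]_n * 'cV[R]_m) :=
  [set p | exists t_ : nat -> R,
     [/\ forall k, t0 <= t_ k,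
         t_ k @[k --> \oo] --> +oo
       & (x (t_ k), y (t_ k)) @[k --> \oo] --> p]].

Definition num_positive (R : realType) (n s : nat) (x : 'cV[R]_n) : nat :=
  #|[pred i : 'I_n | (i < s)%N && (0 < x i 0)]|.

Definition strictly_complementary (R : realType) (n s : nat)
    (le_sn : (s <= n)%N) (x : 'cV[R]_n) (z : 'cV[R]_s) : Prop :=
  forall i : 'I_s, x (widen_ord le_sn i) 0 * z i 0 = 0 /\
                   0 < x (widen_ord le_sn i) 0 + z i 0.

(* Main.v *)
(* For a Karush-Kuhn-Tucker pair (xs, ys) consider the Lyapunov function
     V(x, y) = sum_i D_i(xs_i, x_i) + |y - ys|^2 / (2 sigma2),
   where D_i is the Bregman-type divergence with d/du D_i(c, u) =
   (u - c) / u^(2 gamma) for i <= s, and (u - c)^2 / 2 otherwise. Along the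
   trajectory V decreases at the rate
     (grad f(x) - grad f(xs)).(x - xs) + sigma1 |A x - b|^2 + zs.x,
   a sum of nonnegative terms. Hence the trajectory is bounded, a coordinate
   with xs_i > 0 stays away from 0, and (Barbalat) the rate vanishes at every
   limit point, which makes its x-part primal optimal. V is constant on the set
   of limit points; evaluating V with xs := x1 and then xs := x2 at two limit
   points (x1, y1), (x2, y2) gives x1 = x2 and |y1 - ys| = |y2 - ys|. Under
   strict complementarity ys may be moved to ys + e (y1 - y2), and equality of
   the distances to both points forces y1 = y2. *)
Require Import Defs.
From HB Require Import structures.
From mathcomp Require Import all_boot all_order all_algebra.
From mathcomp Require Import all_classical all_reals all_analysis.
From mathcomp Require Import ring lra.
Import Order.TTheory GRing.Theory Num.Theory.
Import numFieldNormedType.Exports.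
Local Open Scope classical_set_scope.
Local Open Scope ring_scope.

(** * The Euclidean inner product on columns *)

Section dot.
Context {R : realType}.
Definition dot {n} (u v : 'cV[R]_n) : R := \sum_i u i 0 * v i 0.

Lemma dotE {n} (u v : 'cV[R]_n) : dot u v = (u^T *m v) 0 0.
Proof. by rewrite mxE; apply: eq_bigr => i _; rewrite mxE. Qed.

Lemma dotC {n} (u v : 'cV[R]_n) : dot u v = dot v u.
Proof. by apply: eq_bigr => i _; rewrite mulrC. Qed.

Lemma dotDl {n} (u v w : 'cV[R]_n) : dot (u + v) w = dot u w + dot v w.
Proof. by rewrite !dotE linearD mulmxDl mxE. Qed.

Lemma dotDr {n} (u v w : 'cV[R]_n) : dot u (v + w) = dot u v + dot u w.
Proof. by rewrite !dotE mulmxDr mxE. Qed.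

Lemma dotNl {n} (u v : 'cV[R]_n) : dot (- u) v = - dot u v.
Proof. by rewrite !dotE linearN mulNmx mxE. Qed.

Lemma dotNr {n} (u v : 'cV[R]_n) : dot u (- v) = - dot u v.
Proof. by rewrite dotC dotNl dotC. Qed.

Lemma dotBl {n} (u v w : 'cV[R]_n) : dot (u - v) w = dot u w - dot v w.
Proof. by rewrite dotDl dotNl. Qed.

Lemma dotBr {n} (u v w : 'cV[R]_n) : dot u (v - w) = dot u v - dot u w.
Proof. by rewrite dotDr dotNr. Qed.

Lemma dotZl {n} (a : R) (u v : 'cV[R]_n) : dot (a *: u) v = a * dot u v.
Proof. by rewrite !dotE linearZ -scalemxAl mxE. Qed.

Lemma dotZr {n} (a : R) (u v : 'cV[R]_n) : dot u (a *: v) = a * dot u v.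
Proof. by rewrite dotC dotZl dotC. Qed.

Lemma dot0l {n} (u : 'cV[R]_n) : dot 0 u = 0.
Proof. by rewrite dotE linear0 mul0mx mxE. Qed.

Lemma dot0r {n} (u : 'cV[R]_n) : dot u 0 = 0.
Proof. by rewrite dotC dot0l. Qed.

Lemma dot_mulmx {m n} (A : 'M[R]_(m, n)) u v :
  dot (A *m u) v = dot u (A^T *m v).
Proof. by rewrite !dotE trmx_mul mulmxA. Qed.

Lemma dot_ge0 {n} (u : 'cV[R]_n) : 0 <= dot u u.
Proof. by apply: sumr_ge0 => i _; rewrite -expr2 sqr_ge0. Qed.

Lemma dot_eq0 {n} (u : 'cV[R]_n) : dot u u = 0 -> u = 0.
Proof.
move=> /eqP; rewrite psumr_eq0 => [/allP u0|i _]; last by rewrite -expr2 sqr_ge0.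
apply/colP => i; rewrite mxE; apply/eqP.
by have := u0 i (mem_index_enum i); rewrite -expr2 sqrf_eq0.
Qed.

(** Expanding the last equality and cancelling [dot u u = dot v v] leaves [e * dot (u - v) d = 0],
    that is, [e * dot d d = 0]. It will separate two dual limit points that are equidistant from two
    centres. *)
Lemma equidistant_eq0 {n} (u v d : 'cV[R]_n) (e : R) : 0 < e -> u - v = d ->
  dot u u = dot v v -> dot (u - e *: d) (u - e *: d) = dot (v - e *: d) (v - e *: d) ->
  d = 0.
Proof.
move=> e0 uvd uv; rewrite !(dotBl, dotBr) !(dotZl, dotZr) !(dotC d) uv => uvde.
apply: dot_eq0; rewrite -{1}uvd dotBl; apply: (mulfI (lt0r_neq0 e0)).
by rewrite mulr0; lra.
Qed.

Lemma dot_delta {n} (u : 'cV[R]_n) i : dot u (delta_mx i 0) = u i 0.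
Proof.
rewrite /dot (bigD1 i)//= big1 => [|j ji]; first by rewrite mxE !eqxx mulr1 addr0.
by rewrite mxE (negbTE ji) mulr0.
Qed.

Lemma euclidean_norm_dot {n} (u : 'cV[R]_n) :
  euclidean_norm u = Num.sqrt (dot u u).
Proof. by congr Num.sqrt; apply: eq_bigr => i _; rewrite expr2. Qed.

End dot.

(** * Farkas' lemma *)

Section farkas.
Context {R : realType} {n : nat}.

(** The finitely generated convex cone, built one nonnegative multiple at a time, so that
    multipliers can be read off by induction on membership. *)
Inductive cone (s : seq 'cV[R]_n) : 'cV[R]_n -> Prop :=
| cone0 : cone s 0
| coneD u a k : cone s u -> a \in s -> 0 <= k -> cone s (u + k *: a).

Lemma cone_cons a s u : cone s u -> cone (a :: s) u.
Proof.
elim=> [|{}u b k _ cu bs k0]; first exact: cone0.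
by apply: coneD => //; rewrite inE bs orbT.
Qed.

Lemma dot_cone s v u : (forall a, a \in s -> 0 <= dot a v) -> cone s u ->
  0 <= dot u v.
Proof.
move=> sv; elim=> [|{}u a k _ uv sa k0]; first by rewrite dot0l.
by rewrite dotDl dotZl addr_ge0// mulr_ge0// sv.
Qed.

(* Bartl's proof: if [c] is not already a consequence of the tail [s], pick a
   witness [w] and project along [w] onto the functionals vanishing at [w]. *)
Lemma farkas (s : seq 'cV[R]_n) (c : 'cV[R]_n) :
  (forall v, (forall a, a \in s -> 0 <= dot a v) -> 0 <= dot c v) -> cone s c.
Proof.
have [k] := ubnP (size s).
elim: k s c => // k IH [|a s] c sk hc.
  have h v : 0 <= dot c v by apply: hc.
  suff -> : c = 0 by exact: cone0.
  by apply/dot_eq0/eqP; rewrite eq_le dot_ge0 andbT -oppr_ge0 -dotNr h.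
have [hs|] := pselect (forall v, (forall b, b \in s -> 0 <= dot b v) -> 0 <= dot c v).
  by apply/cone_cons/IH.
move=> /existsNP[w] /not_implyP[sw /negP]; rewrite -ltNge => cw.
have aw : dot a w < 0.
  rewrite ltNge; apply/negP => aw; move: cw; rewrite ltNge => /negP; apply.
  by apply: hc => b; rewrite inE => /predU1P[->|/sw].
pose pr b : 'cV[R]_n := b - (dot b w / dot a w) *: a.
pose q v : 'cV[R]_n := v - (dot a v / dot a w) *: w.
(* The projections [pr] and [q] are adjoint, and [dot a (q v) = 0]. So a vector that is nonnegative
   on the projected generators yields [q v], nonnegative on all of [a :: s]. *)
have prq b v : dot (pr b) v = dot b (q v).
  by rewrite dotBl dotZl dotBr dotZr; ring.
have : cone (map pr s) (pr c).
  apply: IH; first by rewrite size_map.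
  move=> v prv; rewrite prq; apply: hc => b; rewrite inE => /predU1P[->|bs].
    by rewrite dotBr dotZr divfK ?subrr// lt_eqF.
  by rewrite -prq prv// map_f.
have cone_pr u' : cone (map pr s) u' -> exists2 u, cone s u & u' = pr u.
  elim=> [|{}u' b j _ [u cu ->] /mapP[b' b's ->] j0].
    by exists 0; [exact: cone0|rewrite /pr dot0l mul0r scale0r subrr].
  exists (u + j *: b'); first exact: coneD.
  rewrite /pr dotDl dotZl scalerBr scalerA mulrDl scalerDl -!mulrA opprD.
  by rewrite addrACA.
move=> /cone_pr[u cu cE].
(* The coefficient of [a] is nonnegative: [dot c w < 0 <= dot u w] and [dot a w < 0]. *)
have -> : c = u + ((dot c w - dot u w) / dot a w) *: a.
  rewrite mulrBl scalerBl; move/eqP: cE; rewrite /pr subr_eq => /eqP {1}->.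
  by rewrite addrAC addrA.
apply: coneD; [exact: cone_cons|by rewrite inE eqxx|].
have uw := dot_cone _ _ _ sw cu.
rewrite -mulrNN -invrN mulr_ge0 ?invr_ge0; lra.
Qed.

End farkas.

(** * Gradients, one-sided directional bounds and convexity *)

Section gradient.
Context {R : realType} {n : nat}.
Implicit Types (f : 'cV[R]_n -> R) (x v : 'cV[R]_n).

Lemma derive_gradient f x v :
  differentiable f x -> 'D_v f x = dot (gradient f x) v.
Proof.
move=> df; rewrite deriveE// [in LHS](matrix_sum_delta v) linear_sum.
apply: eq_bigr => i _; rewrite big_ord1 linearZ/= mxE deriveE//.
by rewrite mulrC.
Qed.

Lemma directional_quotient_cvg f x v : differentiable f x ->
  h^-1 * (f (x + h *: v) - f x) @[h --> 0^'+] --> dot (gradient f x) v.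
Proof.
move=> df; rewrite -derive_gradient//.
have dr : (0 : R)^'+ `=>` 0^'.
  by apply: within_subset => h /=; rewrite lt_neqAle eq_sym => /andP[].
apply: cvg_trans (@diff_derivable _ _ _ f x v df).
apply: cvg_trans; last exact: cvg_app dr.
apply: near_eq_cvg; apply: nearW => h /=.
by rewrite [h *: v + x]addrC.
Qed.

(** Only small positive steps [h] enter, because feasible directions and convex combinations control
    [f] on one side only. *)
Lemma dot_gradient_le f x v k : differentiable f x ->
  (\forall h \near 0^'+, f (x + h *: v) - f x <= h * k) ->
  dot (gradient f x) v <= k.
Proof.
move=> df xk; have cq := directional_quotient_cvg f x v df.
rewrite -(cvg_lim _ cq)//; apply: limr_le; first by apply/cvg_ex; eexists; exact: cq.
near=> h; have h0 : 0 < h by [].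
by rewrite ler_pdivrMl//; near: h.
Unshelve. all: by end_near. Qed.

Lemma le_dot_gradient f x v k : differentiable f x ->
  (\forall h \near 0^'+, h * k <= f (x + h *: v) - f x) ->
  k <= dot (gradient f x) v.
Proof.
move=> df xk; have cq := directional_quotient_cvg f x v df.
rewrite -(cvg_lim _ cq)//; apply: limr_ge; first by apply/cvg_ex; eexists; exact: cq.
near=> h; have h0 : 0 < h by [].
by rewrite ler_pdivlMl//; near: h.
Unshelve. all: by end_near. Qed.

Lemma convex_gradient_le f x y :
  convex_function [set: convex_lmodType 'cV[R]_n] f -> differentiable f x ->
  f x + dot (gradient f x) (y - x) <= f y.
Proof.
move=> cf df; rewrite -lerBrDl; apply: dot_gradient_le => //.
near=> h; have h0 : 0 < h by [].
have h1 : h <= 1 by near: h; apply: nbhs_right_le.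
(* The convexity hypothesis takes its weight as a bundled element of the unit interval; the weight
   [h] goes to [y] and [1 - h] to [x]. *)
have h01 : Itv.spec (@Itv.num_sem R) (Itv.Real `[0%Z, 1%Z]) h.
  by rewrite /= /Itv.num_sem/= num_real/= in_itv/= ltW.
have := cf (Itv.mk h01) y x (mem_setT _) (mem_setT _).
rewrite [X in f X <= _](_ : _ = x + h *: (y - x)).
  by rewrite convRE /= /unstable.onem => fh; lra.
rewrite -[LHS]/(h *: y + (1 - h) *: x) scalerBl scale1r scalerBr.
by rewrite addrCA -[RHS]/(x + (_ - _)).
Unshelve. all: by end_near. Qed.

Lemma convex_gradient_monotone f x y :
  convex_function [set: convex_lmodType 'cV[R]_n] f ->
  differentiable f x -> differentiable f y ->
  0 <= dot (gradient f x - gradient f y) (x - y).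
Proof.
move=> cf dx dy.
have := convex_gradient_le f x y cf dx; have := convex_gradient_le f y x cf dy.
rewrite -[y - x]opprB dotNr dotBl; lra.
Qed.

End gradient.

(** * Karush-Kuhn-Tucker pairs and duality *)

Section kkt.
Context {R : realType} {m n s : nat} (le_sn : (s <= n)%N).
Context (f : 'cV[R]_n -> R) (A : 'M[R]_(m, n)) (b : 'cV[R]_m).

Definition kkt_gradient (x : 'cV[R]_n) (y : 'cV[R]_m) : 'cV[R]_n :=
  gradient f x + A^T *m y.

(** The multiplier of the sign constraints is not a separate variable: stationarity forces it to be
    [kkt_gradient x y], which is therefore zero outside the first [s] coordinates. *)
Definition kkt (x : 'cV[R]_n) (y : 'cV[R]_m) : Prop :=
  primal_feasible s A b x /\
  forall i : 'I_n,
    if (i < s)%N then 0 <= kkt_gradient x y i 0 /\ x i 0 * kkt_gradient x y i 0 = 0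
    else kkt_gradient x y i 0 = 0.

(** The matrix of the projection onto the first [s] coordinates. Its transpose extends a vector by
    zeros, which turns the sum of the [x_i z_i] into an inner product in the full space. *)
Definition extend_mx : 'M[R]_(s, n) := rowsub (widen_ord le_sn) (1%:M : 'M[R]_n).

Lemma extend_mxE (x : 'cV[R]_n) : extend_mx *m x = rowsub (widen_ord le_sn) x.
Proof. by rewrite mul_rowsub_mx mul1mx. Qed.

Lemma lagrangianE x y (z : 'cV[R]_s) :
  f x + (y^T *m (A *m x - b)) 0 0 - \sum_(i < s) x (widen_ord le_sn i) 0 * z i 0
  = f x + dot y (A *m x - b) - dot x (extend_mx^T *m z).
Proof.
rewrite -dotE -dot_mulmx extend_mxE; congr (_ - _).
by apply: eq_bigr => i _; rewrite mxE.
Qed.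

Lemma extend_tr_widen (z : 'cV[R]_s) i : (extend_mx^T *m z) (widen_ord le_sn i) 0 = z i 0.
Proof.
rewrite mxE (bigD1 i)//= !mxE eqxx mul1r big1 ?addr0// => j ji.
by rewrite !mxE -val_eqE/= val_eqE (negbTE ji) mul0r.
Qed.

Lemma extend_tr_out (z : 'cV[R]_s) (i : 'I_n) : (s <= i)%N -> (extend_mx^T *m z) i 0 = 0.
Proof.
move=> si; rewrite mxE big1// => j _; rewrite !mxE -val_eqE/= ltn_eqF ?mul0r//.
exact: leq_trans (ltn_ord j) si.
Qed.

Lemma extend_tr_rowsub (u : 'cV[R]_n) :
  (forall i : 'I_n, (s <= i)%N -> u i 0 = 0) ->
  extend_mx^T *m rowsub (widen_ord le_sn) u = u.
Proof.
move=> u0; apply/colP => i; have [si|is_] := leqP s i.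
  by rewrite extend_tr_out// u0.
rewrite (_ : i = widen_ord le_sn (Ordinal is_)); last exact: val_inj.
by rewrite extend_tr_widen mxE.
Qed.

(** Weak duality: at a feasible [x] the residual vanishes and the subtracted sum is nonnegative. *)
Lemma dual_function_le x y (z : 'cV[R]_s) : primal_feasible s A b x ->
  (forall i, 0 <= z i 0) -> (dual_function le_sn f A b y z <= (f x)%:E)%E.
Proof.
move=> [Ax x0] z0; apply: ge_ereal_inf; eexists; first by exists x.
rewrite lee_fin -dotE Ax subrr dot0r addr0 lerBlDr lerDl.
by apply: sumr_ge0 => i _; rewrite mulr_ge0// x0//= ltn_ord.
Qed.

Lemma kkt_dot x y x' : kkt x y -> 
  dot x' (kkt_gradient x y) = dot x' (extend_mx^T *m rowsub (widen_ord le_sn) (kkt_gradient x y)).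
Proof.
move=> [_ xy]; rewrite extend_tr_rowsub// => i si.
by have := xy i; rewrite ltnNge si.
Qed.

Lemma kkt_compl x y : kkt x y -> dot x (kkt_gradient x y) = 0.
Proof.
move=> [_ xy]; apply: big1 => i _; have := xy i.
by case: ifP => [_ []//|_ ->]; rewrite mulr0.
Qed.

Hypothesis f_convex : convex_function [set: convex_lmodType 'cV[R]_n] f.
Hypothesis f_diff : forall x, differentiable f x.

(** Strong duality: the Lagrangian is convex in its first argument with zero gradient at [x], so [x]
    attains the infimum, and complementary slackness reduces its value there to [f x]. *)
Lemma kkt_dual_function x y : kkt x y ->
  (dual_function le_sn f A b y (rowsub (widen_ord le_sn) (kkt_gradient x y))
    = (f x)%:E)%E.
Proof.
move=> xy; have [[Ax x0] xyi] := xy; apply/eqP; rewrite eq_le.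
rewrite dual_function_le//=; last first.
  by move=> i; rewrite mxE; have := xyi (widen_ord le_sn i); rewrite /= ltn_ord => -[].
apply: le_ereal_inf_tmp => _ [x' _ <-]; rewrite lee_fin lagrangianE -kkt_dot//.
have := convex_gradient_le f x x' f_convex (f_diff x).
have := kkt_compl _ _ xy.
rewrite -Ax -mulmxBr !(dotC y) dot_mulmx /kkt_gradient !dotDr !(dotC (gradient f x)) !dotBl !dotNl.
lra.
Qed.

Lemma kkt_dual_optimal x y : kkt x y ->
  dual_optimal le_sn f A b (y, rowsub (widen_ord le_sn) (kkt_gradient x y)).
Proof.
move=> xy; have [xf xyi] := xy; split.
  by move=> i; rewrite mxE; have := xyi (widen_ord le_sn i); rewrite /= ltn_ord => -[].
by move=> [y' z'] z'0; rewrite /= kkt_dual_function// dual_function_le.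
Qed.

(** The constraints are affine, so each [v] with [A *m v = 0] and [v i 0 >= 0] on the active
    coordinates is a feasible direction. Optimality makes the gradient nonnegative along it, and
    Farkas' lemma turns this into multipliers. *)
Lemma primal_optimal_kkt x : primal_optimal s f A b x -> exists y, kkt x y.
Proof.
move=> [[Ax x0] xmin].
pose active := [pred i : 'I_n | (i < s)%N && (x i 0 == 0)].
pose units : seq 'cV[R]_m := [seq delta_mx j 0 | j <- enum 'I_m].
(* The equation [A *m v = 0] is encoded by pairs of opposite inequalities. *)
pose gens := [seq delta_mx i 0 | i <- enum active] ++
             [seq A^T *m w | w <- units] ++ [seq A^T *m - w | w <- units].
have /farkas : forall v, (forall a, a \in gens -> 0 <= dot a v) ->
    0 <= dot (gradient f x) v.
  move=> v gv.
  have v0 i : active i -> 0 <= v i 0.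
    move=> ai; rewrite -dot_delta dotC; apply: gv.
    by rewrite mem_cat (map_f (fun i => delta_mx i 0))// mem_enum.
  have Av : A *m v = 0.
    apply/colP => j; rewrite [RHS]mxE -dot_delta dotC; apply/eqP; rewrite eq_le.
    rewrite -oppr_ge0 -dotNl -(trmxK A) -!dot_mulmx.
    have ju : delta_mx j 0 \in units by rewrite (map_f (fun j => delta_mx j 0))// mem_enum.
    apply/andP; split; apply: gv; rewrite !mem_cat; apply/or3P.
      by apply: Or33; exact: (map_f (fun w => A^T *m - w)).
    by apply: Or32; exact: (map_f (fun w => A^T *m w)).
  have xv (i : 'I_n) : \forall h \near 0^'+, (i < s)%N -> 0 <= (x + h *: v) i 0.
    have [is_|_] := boolP (i < s)%N; last by apply: nearW.
    have [xi0|] := eqVneq (x i 0) 0.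
      near=> h => _; have h0 : 0 < h by [].
      by rewrite !mxE xi0 add0r mulr_ge0 ?v0//= ?is_ ?xi0 ?eqxx ?ltW.
    rewrite neq_lt ltNge x0//= => xi0.
    (* Steps up to this length keep the coordinate nonnegative; the added 1 avoids dividing by zero
       when [v i 0 = 0]. *)
    have d0 : 0 < x i 0 / (`|v i 0| + 1) by rewrite divr_gt0// ltr_wpDl.
    near=> h => _; have h0 : 0 < h by [].
    have : h <= x i 0 / (`|v i 0| + 1) by near: h; exact: nbhs_right_le.
    rewrite !mxE ler_pdivlMr ?ltr_wpDl// => hx.
    have : - v i 0 <= `|v i 0| by rewrite -normrN ler_norm.
    by move=> /(ler_wpM2l (ltW h0)); lra.
  apply: le_dot_gradient => //; near=> h; have h0 : 0 < h by [].
  rewrite mulr0 subr_ge0; apply: xmin; split.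
    by rewrite mulmxDr -scalemxAr Av scaler0 addr0.
  by near: h; apply: filter_forall.
(* Generators of the first kind contribute to [z]; those of the other two kinds shift [y] in either
   direction. *)
move=> c; have [y [z [z0 zE gE]]] : exists (y : 'cV[R]_m) (z : 'cV[R]_n), [/\ forall i, 0 <= z i 0,
    forall i, ~~ active i -> z i 0 = 0 & gradient f x = z - A^T *m y].
  elim: c => [|u a k _ [y [z [z0 zE ->]]]].
    by exists 0, 0; rewrite mulmx0 subr0; split=> // i *; rewrite mxE.
  rewrite !mem_cat => /or3P[/mapP[i + ->] k0|/mapP[w _ ->] k0|/mapP[w _ ->] k0].
  - rewrite mem_enum => ai; exists y, (z + k *: delta_mx i 0).
    split; last by rewrite addrAC.
    + move=> j; rewrite !mxE addr_ge0// mulr_ge0//.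
    + move=> j nj; rewrite !mxE zE// add0r; have [ji|] := eqVneq j i; last by rewrite mulr0.
      by case/negP: nj; rewrite ji.
  - exists (y - k *: w), z; split => //.
    by rewrite mulmxBr -scalemxAr opprB addrA addrAC -addrA addrCA addrA.
  - exists (y + k *: w), z; split => //.
    by rewrite mulmxN scalerN mulmxDr -scalemxAr opprD addrA.
exists y; split=> // i; rewrite /kkt_gradient gE subrK.
case: ifPn => is_; last by rewrite zE// /active/= (negbTE is_).
split=> //; have [->|xi0] := eqVneq (x i 0) 0; first by rewrite mul0r.
by rewrite zE ?mulr0// /active/= (negbTE xi0) andbF.
Unshelve. all: by end_near. Qed.

(** Some KKT multiplier shows the dual value to be [f x], so the Lagrangian at [d] is at least [f x]
    everywhere. At [x] itself this forces complementary slackness; hence [x] minimizes it and its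
    gradient there is zero. *)
Lemma dual_optimal_kkt x d : primal_optimal s f A b x ->
  dual_optimal le_sn f A b d ->
  kkt x d.1 /\ d.2 = rowsub (widen_ord le_sn) (kkt_gradient x d.1).
Proof.
move=> xopt [d0 dmax]; have [[Ax x0] _] := xopt.
have [y xy] := primal_optimal_kkt _ xopt.
have fd x' : f x <= f x' + dot d.1 (A *m x' - b) - dot x' (extend_mx^T *m d.2).
  rewrite -lee_fin -lagrangianE -(kkt_dual_function _ _ xy).
  apply: le_trans (dmax _ (kkt_dual_optimal _ _ xy).1) _.
  by apply: ereal_inf_lbound; exists x'.
have ez i : 0 <= (extend_mx^T *m d.2) i 0.
  have [si|is_] := leqP s i; first by rewrite extend_tr_out.
  rewrite (_ : i = widen_ord le_sn (Ordinal is_)); last exact: val_inj.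
  by rewrite extend_tr_widen.
have xz i : 0 <= x i 0 * (extend_mx^T *m d.2) i 0.
  have [si|is_] := leqP s i; first by rewrite extend_tr_out// mulr0.
  by rewrite mulr_ge0// x0.
have dxz : dot x (extend_mx^T *m d.2) = 0.
  apply/eqP; rewrite eq_le sumr_ge0// andbT.
  by have := fd x; rewrite Ax subrr dot0r addr0; lra.
have gE : kkt_gradient x d.1 = extend_mx^T *m d.2.
  suff : dot (extend_mx^T *m d.2 - kkt_gradient x d.1)
             (extend_mx^T *m d.2 - kkt_gradient x d.1) <= 0.
    move=> le0; apply/esym/eqP; rewrite -subr_eq0; apply/eqP/dot_eq0/eqP.
    by rewrite eq_le le0 dot_ge0.
  (* The first-order condition is tested in the direction of minus the Lagrangian gradient, which
     bounds the squared norm of that gradient by 0. *)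
  set v := extend_mx^T *m d.2 - _.
  suff : dot (extend_mx^T *m d.2 - A^T *m d.1) v <= dot (gradient f x) v.
    by rewrite {2}/v /kkt_gradient !dotBl dotDl; lra.
  clearbody v.
  apply: le_dot_gradient => //; apply: nearW => h.
  have := fd (x + h *: v).
  have -> : A *m (x + h *: v) - b = h *: (A *m v).
    by rewrite mulmxDr Ax -scalemxAr [LHS]addrC addKr.
  rewrite dotDl dxz add0r.
  by rewrite !dotZl dotZr dotBl (dotC d.1) dot_mulmx !(dotC v); lra.
split; last by rewrite gE; apply/colP => i; rewrite mxE extend_tr_widen.
split=> // i; rewrite gE; case: ifPn => is_; last by rewrite extend_tr_out// leqNgt.
split=> //; apply/eqP; rewrite eq_le xz andbT -dxz /dot.
by rewrite (bigD1 i)//= lerDl sumr_ge0.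
Qed.

Lemma kkt_primal_optimal x y : kkt x y -> primal_optimal s f A b x.
Proof.
move=> xy; split; first by case: xy.
move=> x' x'f; rewrite -lee_fin -(kkt_dual_function _ _ xy) dual_function_le//.
by case: (kkt_dual_optimal _ _ xy).
Qed.

(** Primal and dual solutions can be paired freely: [y'] is part of a dual solution, and that
    solution forms a KKT pair with every primal solution. *)
Lemma kkt_exchange x y x' y' : kkt x y -> kkt x' y' -> kkt x y'.
Proof.
move=> xy x'y'.
have := dual_optimal_kkt _ _ (kkt_primal_optimal _ _ xy) (kkt_dual_optimal _ _ x'y').
by case.
Qed.

End kkt.

(** * The mean value theorem and monotonicity from the derivative *)

Section mean_value.
Context {R : realType}.

Lemma MVT_derive (F dF : R -> R) (a b : R) : a < b ->
  (forall u, a <= u <= b -> is_derive u 1 F (dF u)) ->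
  exists2 c, a < c < b & F b - F a = dF c * (b - a).
Proof.
move=> ab dFF; have [||c] := @MVT _ F dF a b ab.
- by move=> u; rewrite in_itv/= => /andP[au ub]; apply: dFF; rewrite !ltW.
- apply: derivable_within_continuous => u; rewrite in_itv/= => uab.
  by have := dFF u uab => -[].
by rewrite in_itv/= => cab FE; exists c.
Qed.

Lemma derive_nonneg_le (F dF : R -> R) (a b : R) : a <= b ->
  (forall u, a <= u <= b -> is_derive u 1 F (dF u)) ->
  (forall u, a <= u <= b -> 0 <= dF u) -> F a <= F b.
Proof.
rewrite le_eqVlt => /predU1P[->//|ab] dFF dF0.
have [c /andP[ac cb] FE] := MVT_derive F dF a b ab dFF.
by rewrite -subr_ge0 FE mulr_ge0 ?dF0 ?subr_ge0 ?ltW.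
Qed.

End mean_value.

(** * The one-dimensional divergence *)

Section bregman.
Context {R : realType} (gamma : R).
Hypotheses (gamma_ge : 2^-1 <= gamma) (gamma_lt1 : gamma < 1).

(* Antiderivatives on the positive half-line of [u / u^(2 gamma)] and
   [1 / u^(2 gamma)]; the absolute value makes the first one continuous at 0. *)
Definition prim1 (u : R) : R := `|u| `^ (2 - 2 * gamma) / (2 - 2 * gamma).
Definition prim0 (u : R) : R :=
  if gamma == 2^-1 then ln u else u `^ (1 - 2 * gamma) / (1 - 2 * gamma).

(** The diagonal entry of the squared scaling matrix; [pos] tells whether the coordinate is
    sign-constrained. *)
Definition rate (pos : bool) (u : R) : R := if pos then (u `^ gamma) ^+ 2 else 1.

(** Normalized to vanish at [u = c]. For [c = 0] the factor [c] removes [prim0], so that the value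
    at [u = 0] is meaningful. *)
Definition bregman (pos : bool) (c u : R) : R :=
  if pos then prim1 u - c * prim0 u - (prim1 c - c * prim0 c)
  else 2^-1 * (u - c) ^+ 2.

Lemma rate_gt0 (pos : bool) (u : R) : (pos -> 0 < u) -> 0 < rate pos u.
Proof. by case: pos => [/(_ isT) u0|_] //=; rewrite exprn_gt0// powR_gt0. Qed.

Lemma rate_powR (u : R) : rate true u = u `^ (2 * gamma).
Proof. by rewrite /rate mulrC powRrM powR_mulrn// powR_ge0. Qed.

(** The exponent [2 * gamma] is at least 1. This is what makes the divergence from a positive [c]
    blow up at 0. *)
Lemma rate_le_id (u : R) : 0 < u -> u <= 1 -> rate true u <= u.
Proof.
move=> u0 u1; rewrite rate_powR ge1r_powR ?u0//.
by move: gamma_ge; lra.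
Qed.

Lemma rate_le_sqr (u : R) : 1 <= u -> rate true u <= u ^+ 2.
Proof.
move=> u1; rewrite /rate lerXn2r// ?nnegrE ?powR_ge0//; first lra.
by rewrite ler1_powR// ltW.
Qed.

Lemma is_derive_prim1 (u : R) : 0 < u -> is_derive u 1 prim1 (u / rate true u).
Proof.
move=> u0; have g2 : 2 - 2 * gamma != 0 by move: gamma_lt1 => ?; rewrite gt_eqF//; lra.
pose h : R -> R := (2 - 2 * gamma)^-1 \*: ((@powR R) ^~ (2 - 2 * gamma)).
apply: (@near_eq_is_derive _ _ _ h).
  near=> v; have v0 : 0 < v by near: v; exact: lt_nbhsr.
  by rewrite /h /prim1/= gtr0_norm// [RHS]mulrC.
have dp := is_derive1_powR (2 - 2 * gamma) u0.
rewrite rate_powR /h; apply: is_derive_eq.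
rewrite /GRing.scale/= mulrA mulVf// mul1r -powRN -{2}(powRr1 (ltW u0)) -powRD.
  by congr (_ `^ _); ring.
by apply/implyP => _; rewrite gt_eqF.
Unshelve. all: by end_near. Qed.

Lemma is_derive_prim0 (u : R) : 0 < u -> is_derive u 1 prim0 (rate true u)^-1.
Proof.
move=> u0; rewrite rate_powR -powRN /prim0; have [g12|g12] := eqVneq gamma 2^-1.
  by rewrite g12 mulfV// powR_inv1 ?ltW//; exact: is_derive1_ln.
have g1 : 1 - 2 * gamma != 0 by move: g12; apply: contra_neq; lra.
have dp := is_derive1_powR (1 - 2 * gamma) u0.
rewrite (_ : (fun u => _) = (1 - 2 * gamma)^-1 \*: ((@powR R) ^~ (1 - 2 * gamma))).
  apply: is_derive_eq; rewrite /GRing.scale/= mulrA mulVf// mul1r.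
  by congr (_ `^ _); ring.
by apply/funext => v /=; rewrite mulrC.
Qed.

Lemma is_derive_bregman (pos : bool) (c u : R) : (pos -> 0 < u) ->
  is_derive u 1 (bregman pos c) ((u - c) / rate pos u).
Proof.
rewrite /bregman; case: pos => [/(_ isT) u0|_]; last first.
  by apply: is_derive_eq; rewrite /GRing.scale/= divr1 subr0; field.
have d1 := is_derive_prim1 _ u0; have d0 := is_derive_prim0 _ u0.
apply: is_derive_eq; rewrite /GRing.scale/=; ring.
Qed.

End bregman.

(** * Positivity, coercivity and continuity of the divergence *)

Section bregman_bounds.
Context {R : realType} (gamma : R).
Hypotheses (gamma_ge : 2^-1 <= gamma) (gamma_lt1 : gamma < 1).

(* The closure points at which the divergence from [c] stays finite. *)
Definition bregman_dom (pos : bool) (c u : R) : Prop :=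
  pos -> [/\ 0 <= c, 0 <= u & 0 < c -> 0 < u].

Let D := bregman gamma.

Lemma prim1_0 : prim1 gamma 0 = 0.
Proof. by rewrite /prim1 normr0 powR0 ?mul0r// gt_eqF//; move: gamma_lt1; lra. Qed.

Lemma bregman0 u : D true 0 u = prim1 gamma u.
Proof. by rewrite /D /bregman !mul0r !subr0 prim1_0 subr0. Qed.

Lemma bregman_self pos c : D pos c c = 0.
Proof. by rewrite /D /bregman; case: pos; rewrite subrr// expr0n/= mulr0. Qed.

(** The derivative has the sign of [u - c], so the divergence decreases strictly to 0 at [c] and
    increases strictly after it. For [c = 0] it is a positive multiple of a power of [u]. *)
Lemma bregman_gt0 pos c u : bregman_dom pos c u -> u != c -> 0 < D pos c u.
Proof.
case: pos => [/(_ isT) [c0 u0 cu] uc|_ uc]; last first.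
  by rewrite mulr_gt0// exprn_even_gt0//= subr_eq0.
have [c00|c_neq0] := eqVneq c 0.
  rewrite c00 bregman0 divr_gt0 ?powR_gt0 ?normr_gt0//; first by rewrite -c00.
  by move: gamma_lt1; lra.
have {}c0 : 0 < c by rewrite lt_neqAle eq_sym c_neq0.
have {}u0 := cu c0.
have dD (v : R) : 0 < v -> is_derive v 1 (D true c) ((v - c) / rate gamma true v).
  by move=> v0; exact: is_derive_bregman.
suff : 0 < D true c u - D true c c by rewrite bregman_self subr0.
have MVTD a b : 0 < a -> a < b ->
    exists2 w, a < w < b & D true c b - D true c a = (w - c) / rate gamma true w * (b - a).
  move=> a0 ab; apply: (MVT_derive _ (fun v => (v - c) / rate gamma true v)) => //.
  by move=> v /andP[av _]; apply: dD; exact: lt_le_trans av.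
move: uc; rewrite neq_lt => /orP[uc|cu'].
  have [w /andP[uw wc] wE] := MVTD _ _ u0 uc.
  have rw : 0 < rate gamma true w by apply: rate_gt0 => _; exact: lt_trans uw.
  have -> : D true c u - D true c c = (c - w) / rate gamma true w * (c - u).
    by rewrite -opprB wE; ring.
  by rewrite mulr_gt0 ?divr_gt0 ?subr_gt0.
have [w /andP[cw wu] ->] := MVTD _ _ c0 cu'.
have rw : 0 < rate gamma true w by apply: rate_gt0 => _; exact: lt_trans cw.
by rewrite mulr_gt0 ?divr_gt0 ?subr_gt0.
Qed.

Lemma bregman_ge0 pos c u : bregman_dom pos c u -> 0 <= D pos c u.
Proof.
move=> cu; have [->|uc] := eqVneq u c; first by rewrite bregman_self.
by rewrite ltW// bregman_gt0.
Qed.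

Lemma bregman_eq0 pos c u : bregman_dom pos c u -> D pos c u = 0 -> u = c.
Proof.
move=> cu D0; apply/eqP; apply/negPn/negP => uc.
by have := bregman_gt0 _ _ _ cu uc; rewrite D0 ltxx.
Qed.

(** In the constrained case, [v >= 1] and [v >= 2 * c] make the derivative at least
    [(v / 2) / v ^+ 2], so the divergence grows at least like [ln u / 2] beyond [M]. *)
Lemma bregman_bounded (pos : bool) c K : (pos -> 0 <= c) ->
  exists M, forall u, (pos -> 0 < u) -> D pos c u <= K -> `|u| <= M.
Proof.
case: pos => [/(_ isT) c0|_]; last first.
  (* From [2 * |a| <= a ^+ 2 + 1] with [a = u - c], where [a ^+ 2 <= 2 * K]. *)
  exists (`|c| + (2 * K + 1)) => u _; rewrite /D /bregman/= => DK.
  have -> : u = c + (u - c) by rewrite addrC subrK.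
  apply: le_trans (ler_normD _ _) _; rewrite lerD2l.
  have : 0 <= (`|u - c| - 1) ^+ 2 by exact: sqr_ge0.
  have := real_normK (num_real (u - c)); have := normr_ge0 (u - c).
  lra.
pose M := 1 + 2 * c; have M0 : 0 < M by rewrite /M; lra.
exists (M + expR (2 * K + ln M)) => u /(_ isT) u0 DK.
rewrite gtr0_norm//; have [uM|Mu] := leP u M.
  by rewrite (le_trans uM)// lerDl expR_ge0.
suff : ln u <= 2 * K + ln M.
  by rewrite -ler_expR lnK ?posrE// => /le_trans; apply; rewrite lerDr ltW.
have DM : 0 <= D true c M by apply: bregman_ge0 => _; split => //; rewrite ltW.
have : D true c M - 2^-1 * ln M <= D true c u - 2^-1 * ln u.
  apply: (derive_nonneg_le (fun v => D true c v - 2^-1 * ln v)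
    (fun v => (v - c) / rate gamma true v - 2^-1 * v^-1)); first exact: ltW.
    move=> v /andP[Mv _]; have v0 : 0 < v by exact: lt_le_trans Mv.
    have d1 := is_derive_bregman gamma gamma_lt1 true c _ (fun _ => v0).
    have d2 := is_derive1_ln v0.
    by apply: is_derive_eq; rewrite /GRing.scale/=; ring.
  move=> v /andP[Mv _]; have v0 : 0 < v by exact: lt_le_trans Mv.
  have v1 : 1 <= v by move: Mv; rewrite /M; lra.
  have rv0 : 0 < rate gamma true v by apply: rate_gt0.
  have rv := rate_le_sqr gamma gamma_lt1 _ v1.
  rewrite subr_ge0 ler_pdivlMr// -mulrA -ler_pdivlMl ?invr_gt0// invrK.
  rewrite ler_pdivrMl//; apply: le_trans rv _; rewrite expr2 ler_pM2l//.
  by move: Mv; rewrite /M; lra.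
lra.
Qed.

(** Below [d] one has [rate <= v] and [c - v >= c / 2], so the derivative is at most
    [- (c / 2) / v]. Hence the divergence at [u < d] is at least [c / 2 * (ln d - ln u)], and the
    bound [K] gives [ln u >= ln d - 2 * K / c]. *)
Lemma bregman_away c K : 0 < c ->
  exists2 d, 0 < d & forall u, 0 < u -> D true c u <= K -> d <= u.
Proof.
move=> c0; pose d := Num.min 1 (c / 2).
have d0 : 0 < d by rewrite lt_min ltr01 divr_gt0.
have d1 : d <= 1 by rewrite ge_min lexx.
have dc : d <= c / 2 by rewrite ge_min lexx orbT.
exists (Num.min d (expR (ln d - 2 * K / c))); first by rewrite lt_min d0 expR_gt0.
move=> u u0 DK; rewrite ge_min; have [//|ud] := leP d u.
rewrite -ler_ln ?posrE ?expR_gt0// expRK/=.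
have Dd : 0 <= D true c d by apply: bregman_ge0 => _; split => //; rewrite ltW.
have : - (D true c u + c / 2 * ln u) <= - (D true c d + c / 2 * ln d).
  apply: (derive_nonneg_le (fun v => - (D true c v + c / 2 * ln v))
    (fun v => - ((v - c) / rate gamma true v + c / 2 * v^-1))); first exact: ltW.
    move=> v /andP[uv _]; have v0 : 0 < v by exact: lt_le_trans uv.
    have d1' := is_derive_bregman gamma gamma_lt1 true c _ (fun _ => v0).
    have d2 := is_derive1_ln v0.
    by apply: is_derive_eq; rewrite /GRing.scale/=; ring.
  move=> v /andP[uv vd]; have v0 : 0 < v by exact: lt_le_trans uv.
  have rv0 : 0 < rate gamma true v by apply: rate_gt0.
  have rv := rate_le_id gamma gamma_ge _ v0 (le_trans vd d1).
  rewrite opprD -mulNr opprB subr_ge0.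
  have c2 : c / 2 <= c - v by move: (le_trans vd dc); lra.
  apply: (@le_trans _ _ (c / 2 / rate gamma true v)).
    by rewrite ler_pM2l ?divr_gt0// lef_pV2.
  by rewrite ler_pM2r ?invr_gt0.
move=> h; have h2 : c * (ln d - ln u) <= 2 * K by lra.
have : ln d - ln u <= 2 * K / c by rewrite ler_pdivlMr// mulrC.
lra.
Qed.

(** In the constrained case the divergence is differentiable at [u > 0], and [bregman_dom] allows
    [u = 0] only with [c = 0], where it reduces to [prim1]. *)
Lemma bregman_continuous pos c u : bregman_dom pos c u ->
  {for u, continuous (D pos c)}.
Proof.
move=> cu; have dcont (F : R -> R) dF : is_derive u 1 F dF -> {for u, continuous F}.
  by case=> dF' _; apply/differentiable_continuous/derivable1_diffP.
case: pos cu => [/(_ isT) [c0 u0 cu]|_]; last first.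
  by apply: dcont; exact: is_derive_bregman.
have [u_eq0|u_neq0] := eqVneq u 0; last first.
  apply: dcont; apply: is_derive_bregman => // _.
  by rewrite lt_neqAle eq_sym u_neq0.
have -> : c = 0.
  by apply/eqP; rewrite eq_le c0 andbT leNgt; apply/negP => /cu; rewrite u_eq0 ltxx.
rewrite (_ : D true 0 = prim1 gamma); last by apply/funext => v; exact: bregman0.
have g2 : 0 < 2 - 2 * gamma by move: gamma_lt1; lra.
rewrite u_eq0.
suff : prim1 gamma v @[v --> (0 : R)] --> (0 : R) by rewrite -{2}prim1_0.
apply/cvgrPdist_le => e e0; have E0 : 0 < e * (2 - 2 * gamma) by rewrite mulr_gt0.
near=> v; have v0 : 0 <= prim1 gamma v by rewrite divr_ge0 ?powR_ge0 ?ltW.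
rewrite sub0r normrN ger0_norm// /prim1.
rewrite ler_pdivrMr//.
have vE : `|v| <= (e * (2 - 2 * gamma)) `^ (2 - 2 * gamma)^-1.
  by near: v; apply: (@nbhs0_le R R^o); exact: powR_gt0.
apply: le_trans (ge0_ler_powR (ltW g2) _ _ vE) _; rewrite ?nnegrE ?powR_ge0//.
rewrite -powRrM mulVf; last by rewrite gt_eqF.
by rewrite powRr1// ltW.
Unshelve. all: by end_near. Qed.

End bregman_bounds.

(** * Coordinatewise convergence and compactness of boxes *)

Section column_topology.
Context {R : realType}.

Lemma cvg_mx_coord {T : Type} {F : set_system T} {FF : Filter F} {m n : nat}
    (M : T -> 'M[R]_(m, n)) (L : 'M[R]_(m, n)) :
  (forall i j, M t i j @[t --> F] --> L i j) -> M t @[t --> F] --> L.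
Proof.
move=> ML; apply/cvgrPdist_le => e e0.
have : \forall t \near F, forall ij : 'I_m * 'I_n, `|L ij.1 ij.2 - M t ij.1 ij.2| <= e.
  by apply: filter_forall => -[i j]; have /cvgrPdist_le := ML i j; apply.
apply: filterS => t Lt.
rewrite /Num.Def.normr/= mx_normrE (bigmax_le _ (ltW e0))// => ij _.
by rewrite !mxE.
Qed.

Lemma cvg_coord {T : Type} {F : set_system T} {FF : Filter F} {m n : nat}
    (M : T -> 'M[R]_(m, n)) (L : 'M[R]_(m, n)) i j :
  M t @[t --> F] --> L -> M t i j @[t --> F] --> L i j.
Proof.
exact: (@continuous_cvg _ _ _ F FF M (fun N : 'M[R]_(m, n) => N i j) L
  (@coord_continuous _ _ _ i j L)).
Qed.

Lemma cvg_sum {T : Type} {F : set_system T} {FF : Filter F} {n : nat}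
    (f : 'I_n -> T -> R) (l : 'I_n -> R) :
  (forall i, f i t @[t --> F] --> l i) ->
  \sum_i f i t @[t --> F] --> \sum_i l i.
Proof.
move=> fl; apply: (@cvg_big R 'I_n +%R 0 xpredT _ T F (index_enum _) f l FF) => //.
exact: (@pseudometric_normed_Zmodule.add_continuous R R^o).
Qed.

Lemma cvg_mulmxr {T : Type} {F : set_system T} {FF : Filter F} {m n : nat}
    (A : 'M[R]_(m, n)) (v : T -> 'cV[R]_n) (l : 'cV[R]_n) :
  v t @[t --> F] --> l -> A *m v t @[t --> F] --> A *m l.
Proof.
move=> vl; apply: cvg_mx_coord => i j; rewrite mxE.
under eq_fun do rewrite mxE.
by apply: cvg_sum => k; apply: cvgM; [exact: cvg_cst|exact: cvg_coord].
Qed.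

Lemma cvg_dot {T : Type} {F : set_system T} {FF : Filter F} {n : nat}
    (u v : T -> 'cV[R]_n) (a b : 'cV[R]_n) :
  u t @[t --> F] --> a -> v t @[t --> F] --> b ->
  dot (u t) (v t) @[t --> F] --> dot a b.
Proof.
by move=> ua vb; apply: cvg_sum => i; apply: cvgM; exact: cvg_coord.
Qed.

(** A product of segments is compact as a set of rows; transposition carries this to columns. *)
Lemma compact_box (n : nat) (M : R) :
  compact [set v : 'cV[R]_n | forall i, `|v i 0| <= M].
Proof.
have cK := @rV_compact R n (fun=> `[- M, M]%classic) (fun=> @segment_compact R _ _).
have tc : continuous (fun v : 'rV[R]_n => v^T).
  move=> v; apply: (@cvg_mx_coord _ (nbhs v) (nbhs_filter v)) => i j; rewrite mxE.
  by under eq_fun do rewrite mxE; exact: coord_continuous.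
rewrite (_ : [set _ | _] =
  (fun v : 'rV[R]_n => v^T) @` [set v : 'rV[R]_n | forall i, `[- M, M]%classic (v ord0 i)]).
  by apply: continuous_compact => //; exact: continuous_subspaceT.
apply/seteqP; split=> [v vM|_ [v vM <-]] /= => [|i].
  by exists v^T; rewrite ?trmxK// => i; rewrite mxE /= in_itv/= -ler_norml ord1.
by have := vM i; rewrite /= in_itv/= mxE -ler_norml ord1.
Qed.

End column_topology.

(** * Limit points of a trajectory *)

Section limit_points.
Context {R : realType} {T : topologicalType} (w : R -> T).

Lemma cluster_freq p (B : set T) (t1 : R) : cluster (w t @[t --> +oo]) p ->
  nbhs p B -> exists2 t, t1 < t & B (w t).
Proof.
move=> pw pB; have [|_ [[t /= tt1 <-] Bt]] := pw [set w t | t in [set t | t1 < t]] B _ pB.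
  by exists t1; split; [exact: num_real|move=> t t1t; exists t].
by exists t.
Qed.

Lemma cluster_near p (B : set T) (P : set R) : cluster (w t @[t --> +oo]) p ->
  nbhs p B -> (\forall t \near +oo, P t) -> exists2 t, P t & B (w t).
Proof.
move=> pw pB [t1 [_ Pt]]; have [t t1t Bt] := cluster_freq _ _ t1 pw pB.
by exists t => //; exact: Pt.
Qed.

Lemma cluster_lim p (h : T -> R) (l : R) : cluster (w t @[t --> +oo]) p ->
  {for p, continuous h} -> h (w t) @[t --> +oo] --> l -> h p = l.
Proof.
move=> pw hp hl; apply/eqP; rewrite -subr_eq0 -normr_le0.
apply/ler_addgt0Pr => e e0; rewrite add0r.
have e2 : 0 < e / 2 by rewrite divr_gt0.
have /cvgrPdist_le /(_ _ e2) hpe := hp; have /cvgrPdist_le /(_ _ e2) hle := hl.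
have [t ht hwt] := cluster_near _ _ _ pw hpe hle.
rewrite (splitr e) (le_trans _ (lerD hwt ht))//.
by rewrite -[X in `|X| <= _](subrKA (h (w t))) (le_trans (ler_normD _ _))// lerD2l distrC.
Qed.

Lemma cluster_le p (h : T -> R) (c : R) : cluster (w t @[t --> +oo]) p ->
  {for p, continuous h} -> (\forall t \near +oo, c <= h (w t)) -> c <= h p.
Proof.
move=> pw hp hc; apply/ler_addgt0Pr => e e0.
have /cvgrPdist_le /(_ _ e0) hpe := hp.
have [t ht /ler_normlP[h1 _]] := cluster_near _ _ _ pw hpe hc.
by move: ht h1 => /=; lra.
Qed.

Lemma sequence_cluster p (t_ : nat -> R) : t_ k @[k --> \oo] --> +oo ->
  w (t_ k) @[k --> \oo] --> p -> cluster (w t @[t --> +oo]) p.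
Proof.
move=> tk wk A B FA pB.
have : \forall k \near \oo, (A `&` B) (w (t_ k)).
  by apply: filterI; [exact: (tk _ FA)|exact: wk].
by move=> /filter_ex[k ABk]; exists (w (t_ k)).
Qed.

Lemma compact_cluster_ex (K : set T) : compact K ->
  (\forall t \near +oo, K (w t)) -> exists p, cluster (w t @[t --> +oo]) p.
Proof. by move=> cK wK; have [p []] := cK (w t @[t --> +oo]) _ wK; exists p. Qed.

(** If [h (w t)] left a neighbourhood of [q] at arbitrarily late times, the filter restricted to
    these times would have a cluster point in [K], where [h] could not equal [q]. With [h] a
    projection, convergence of one component follows from uniqueness of that component alone. *)
Lemma compact_cluster_cvg {U : topologicalType} (K : set T) (h : T -> U) (q : U) :
  compact K -> (\forall t \near +oo, K (w t)) -> continuous h ->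
  (forall p, cluster (w t @[t --> +oo]) p -> h p = q) ->
  h (w t) @[t --> +oo] --> q.
Proof.
move=> cK wK hcont hq B qB; apply: contrapT => nB.
pose N := [set t | ~ B (h (w t))].
have FN : ProperFilter (within N (+oo : set_system R)).
  apply: Build_ProperFilter_ex => P PN; apply: contrapT => nP; apply: nB.
  have : \forall t \near +oo, N t -> P t := PN.
  apply: filterS => t tP; apply: contrapT => Bt; apply: nP; exists t; exact: tP.
have [|p [_ pF]] := cK (w t @[t --> within N +oo]) _.
  by apply: filterS wK => t Kt _.
have pw : cluster (w t @[t --> +oo]) p.
  by apply: cvg_cluster pF; apply: cvg_app; exact: cvg_within.
have pB : nbhs p (h @^-1` B) by apply: hcont; rewrite hq.
have [|_ [[t Nt <-] Bt]] := pF [set w t | t in N] _ _ pB; last exact: (Nt Bt).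
by apply: (filterS _ (withinT N _)) => t Nt; exists t.
Qed.

End limit_points.

(** * Monotone convergence, Barbalat's argument and derivatives at interior times *)

Section asymptotics.
Context {R : realType}.

Lemma nonincreasing_derive_cvg (V dV : R -> R) (t1 c : R) :
  (forall t, t1 <= t -> is_derive t 1 V (dV t)) ->
  (forall t, t1 <= t -> dV t <= 0) -> (forall t, t1 <= t -> c <= V t) ->
  exists l : R, V t @[t --> +oo] --> l.
Proof.
(* Clamping the time at [t1] makes [g] monotone on the whole line without changing it at later
   times. *)
move=> VdV dV0 cV; pose g t := - V (Num.max t1 t).
have gmono : nondecreasing_fun g.
  move=> a b ab; apply: (derive_nonneg_le (fun t => - V t) (fun t => - dV t)).
  - by rewrite ge_max !le_max lexx ab orbT.
  - move=> t /andP[+ _]; rewrite ge_max => /andP[t1t _].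
    by have ? := VdV t t1t; apply: is_deriveN.
  - move=> t /andP[+ _]; rewrite ge_max => /andP[t1t _].
    by rewrite oppr_ge0 dV0.
have gub : has_ubound (range g).
  by exists (- c) => _ [t _ <-]; rewrite lerN2 cV// le_max lexx.
exists (- sup (range g)).
have : (- g t) @[t --> +oo] --> - sup (range g) by apply: cvgN; exact: nondecreasing_cvgr.
have gV : \forall t \near +oo, - g t = V t.
  exists t1; split; first exact: num_real.
  by move=> t t1t; rewrite /g/= opprK max_r// ltW.
by apply: cvg_trans; exact: near_eq_cvg.
Qed.

(* Barbalat's argument: along a trajectory whose speed is bounded, a convergent
   function cannot have a derivative that keeps returning near [G p != 0]. *)
Lemma cluster_derive_eq0 {T : pseudoMetricType R} (w : R -> T) (F : R -> R)
    (G : T -> R) (p : T) (t1 l : R) :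
  (forall r, 0 < r -> exists2 d, 0 < d &
     forall t u, t1 <= t -> t <= u <= t + d -> ball (w t) r (w u)) ->
  (forall t, t1 <= t -> is_derive t 1 F (G (w t))) ->
  F t @[t --> +oo] --> l -> {for p, continuous G} ->
  cluster (w t @[t --> +oo]) p -> G p = 0.
Proof.
move=> slow FG Fl Gp pw; apply/eqP; rewrite -normr_le0.
apply/ler_addgt0Pr => e e0; rewrite add0r.
have e2 : 0 < e / 2 by rewrite divr_gt0.
have /cvgrPdist_le /(_ _ e2) /nbhs_ballP[r /= r0 rG] := Gp.
have r2 : 0 < r / 2 by rewrite divr_gt0.
have [d d0 dw] := slow _ r2.
(* Two such errors change [F] by at most [e / 2 * d] over an interval of length [d], so the mean
   slope there is at most [e / 2]. *)
have ed : 0 < e / 2 * d / 2 by rewrite !mulr_gt0.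
have /cvgrPdist_le /(_ _ ed)[t2 [_ t2F]] := Fl.
have [t t12 wt] := cluster_freq _ _ _ (Num.max t1 t2) pw (nbhsx_ballx p _ r2).
have /andP[t1t t2t] : (t1 < t) && (t2 < t) by rewrite -gt_max.
have [|u tu|u /andP[tu ud] FE] := MVT_derive F (fun u => G (w u)) t (t + d).
- by rewrite ltrDl.
- by apply: FG; case/andP: tu => + _; apply: le_trans; exact: ltW.
have wu : ball p r (w u).
  by rewrite (splitr r); apply: ball_triangle wt _; apply: dw; rewrite !ltW.
have /= Gpu := rG _ wu.
have Gu : `|G (w u)| <= e / 2.
  have F1 := t2F _ t2t; have F2 : `|l - F (t + d)| <= e / 2 * d / 2.
    by apply: t2F; rewrite (lt_trans t2t)// ltrDl.
  rewrite -(ler_pM2r d0) -{1}(gtr0_norm d0) -normrM.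
  have <- : F (t + d) - F t = G (w u) * d by rewrite FE addrC addKr.
  move: F1 F2; rewrite !ler_norml => /andP[? ?] /andP[? ?]; apply/andP; split; lra.
move: Gpu Gu; rewrite !ler_norml => /andP[? ?] /andP[? ?]; apply/andP; split; lra.
Qed.

(** For [t0 < t] a whole neighbourhood of [t] lies in the interval, so the derivative within it is
    an ordinary two-sided one. *)
Lemma is_derivative_in_coord (k : nat) (t0 t : R) (u : R -> 'cV[R]_k)
    (l : 'cV[R]_k) (i : 'I_k) : t0 < t ->
  is_derivative_in `[t0, +oo[ u t l -> is_derive t 1 (fun r => u r i 0) (l i 0).
Proof.
move=> t0t ul.
have shift : (h + t) @[h --> (0 : R)^'] `=>` within `[t0, +oo[ t^'.
  move=> P tP; have {}tP : \forall r \near t, r != t -> `[t0, +oo[%classic r -> P r := tP.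
  have t0r : \forall r \near t, t0 < r by exact: lt_nbhsr.
  have h0t : (h + t) @[h --> (0 : R)] --> 0 + t.
    by apply: cvgD; [exact: cvg_id|exact: cvg_cst].
  rewrite add0r in h0t.
  have : \forall h \near (0 : R), h != 0 -> P (h + t).
    have ht : \forall h \near (0 : R),
      (h + t != t -> `[t0, +oo[%classic (h + t) -> P (h + t)) /\ t0 < h + t.
      exact: h0t _ (filterI tP t0r).
    apply: filterS ht => h [hP t0h] h0.
    apply: hP; first by rewrite -subr_eq0 addrK.
    by rewrite /= in_itv/= andbT ltW.
  by [].
have uil : h^-1 *: (u (h *: 1 + t) i 0 - u t i 0) @[h --> (0 : R)^'] --> l i 0.
  have : (r - t)^-1 * (u r i 0 - u t i 0) @[r --> within `[t0, +oo[ t^'] --> l i 0.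
    rewrite (_ : (fun r => _) = (fun r => ((r - t)^-1 *: (u r - u t)) i 0)).
      exact: cvg_coord.
    by apply/funext => r; rewrite !mxE.
  move=> /(cvg_comp _ _ shift).
  rewrite (_ : _ \o _ = (fun h => h^-1 *: (u (h *: 1 + t) i 0 - u t i 0)))//.
  by apply/funext => h /=; rewrite addrK [h *: 1]mulr1.
by apply: DeriveDef; [apply/cvg_ex; exists (l i 0)|exact: cvg_lim].
Qed.

End asymptotics.

(** * Uniform bounds over coordinates and compact sets *)

Lemma finite_bound {R : realType} {n : nat} (P : 'I_n -> R -> Prop) :
  (forall i M M', M <= M' -> P i M -> P i M') -> (forall i, exists M, P i M) ->
  exists M, forall i, P i M.
Proof.
move=> Pmono /choice[g gP]; exists (\sum_i `|g i|) => i.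
apply: Pmono (gP i); rewrite (bigD1 i)//= (le_trans (ler_norm _))// lerDl.
exact: sumr_ge0.
Qed.

Lemma coord_le_norm {R : realType} {n : nat} (v : 'cV[R]_n) i : `|v i 0| <= `|v|.
Proof.
by rewrite [leRHS]/Num.Def.normr/= mx_normrE (le_bigmax _ _ (i, 0)).
Qed.

Lemma compact_image_bounded {R : realType} {T : topologicalType} {n : nat}
    (K : set T) (h : T -> 'cV[R]_n) : compact K -> continuous h ->
  exists M, forall p i, K p -> `|h p i 0| <= M.
Proof.
move=> cK ch.
have /compact_bounded[M [_ hM]] : compact (h @` K).
  by apply: continuous_compact => //; exact: continuous_subspaceT.
exists (M + 1) => p i Kp; apply: le_trans (coord_le_norm _ _) _.
by apply: hM; [rewrite ltrDl|exists p].
Qed.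

Lemma scaling_mx_sqrE {R : realType} {n : nat} (s : nat) (gamma : R)
    (x v : 'cV[R]_n) i :
  (scaling_mx s gamma x ^+ 2 *m v) i 0 = rate gamma (i < s)%N (x i 0) * v i 0.
Proof.
rewrite expr2 -[_ * _]/(_ *m _) -mulmxA /scaling_mx !mul_diag_mx !mxE mulrA -expr2.
by rewrite /rate; case: ifP => // _; rewrite expr1n.
Qed.

(** * The Lyapunov function *)

Section lyapunov.
Context {R : realType} {m n s : nat}.
Context (f : 'cV[R]_n -> R) (A : 'M[R]_(m, n)) (b : 'cV[R]_m).
Context (gamma sigma1 sigma2 : R).

Local Notation T := ('cV[R]_n * 'cV[R]_m)%type.

Definition aug (p : T) : 'cV[R]_n := aug_gradient f A b sigma1 p.1 p.2.

Definition lyap (xs : 'cV[R]_n) (ys : 'cV[R]_m) (p : T) : R :=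
  \sum_(i < n) bregman gamma (i < s)%N (xs i 0) (p.1 i 0) +
  (2 * sigma2)^-1 * dot (p.2 - ys) (p.2 - ys).

(** Minus the derivative of [lyap] along the flow, in the form given by the chain rule; [dissipE]
    splits it into terms of known sign. *)
Definition dissip (xs : 'cV[R]_n) (ys : 'cV[R]_m) (p : T) : R :=
  dot (p.1 - xs) (aug p) - dot (p.2 - ys) (A *m p.1 - b).

(** Since [A *m xs = b], the two terms in [p.2] cancel and leave [ys] against the residual;
    [gradient f xs] is then added and subtracted. *)
Lemma dissipE xs ys p : A *m xs = b ->
  dissip xs ys p = dot (gradient f p.1 - gradient f xs) (p.1 - xs) +
    sigma1 * dot (A *m p.1 - b) (A *m p.1 - b) +
    dot (p.1 - xs) (kkt_gradient f A xs ys).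
Proof.
move=> Axs; have Ae : A *m (p.1 - xs) = A *m p.1 - b by rewrite mulmxBr Axs.
rewrite /dissip /aug /aug_gradient /kkt_gradient.
move: (p.1 - xs) (A *m p.1 - b) Ae => e r Ae.
rewrite !dotDr dotZr -!dot_mulmx Ae !dotBl (dotC p.2) (dotC ys) !(dotC (gradient f _)).
ring.
Qed.

(** The first term is monotonicity of the gradient, the second a square; in the third, complementary
    slackness removes the contribution of [xs]. *)
Lemma dissip_ge0 xs ys (p : T) :
  convex_function [set: convex_lmodType 'cV[R]_n] f ->
  (forall x, differentiable f x) -> 0 < sigma1 ->
  kkt (s := s) f A b xs ys -> (forall i : 'I_n, (i < s)%N -> 0 <= p.1 i 0) ->
  [/\ 0 <= dot (gradient f p.1 - gradient f xs) (p.1 - xs),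
      0 <= sigma1 * dot (A *m p.1 - b) (A *m p.1 - b) &
      0 <= dot (p.1 - xs) (kkt_gradient f A xs ys)].
Proof.
move=> cf df s0 xys p0; split.
- exact: convex_gradient_monotone.
- by rewrite mulr_ge0 ?dot_ge0 ?ltW.
- rewrite dotBl (kkt_compl _ _ _ _ _ xys) subr0; apply: sumr_ge0 => i _.
  have := xys.2 i; case: ifP => [is_ [z0 _]|_ ->]; last by rewrite mulr0.
  by rewrite mulr_ge0 ?p0.
Qed.

Lemma aug_continuous : continuous (gradient f) -> continuous aug.
Proof.
move=> gc p; have fp : fst q @[q --> p] --> p.1 by exact: cvg_fst.
have sp : snd q @[q --> p] --> p.2 by exact: cvg_snd.
apply: (@cvgD _ _ _ (nbhs p)).
  apply: (@cvgD _ _ _ (nbhs p)); last exact: cvg_mulmxr.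
  by apply: (@continuous_cvg _ _ _ (nbhs p) _ fst (gradient f) p.1) => //; exact: gc.
apply: (@cvgZr _ _ _ (nbhs p)); apply: cvg_mulmxr.
by apply: (@cvgB _ _ _ (nbhs p)); [exact: cvg_mulmxr|exact: cvg_cst].
Qed.

Lemma residual_continuous : continuous (fun p : T => A *m p.1 - b).
Proof.
move=> p; apply: (@cvgB _ _ _ (nbhs p)); last exact: cvg_cst.
by apply: cvg_mulmxr; exact: cvg_fst.
Qed.

Lemma dissip_continuous xs ys : continuous (gradient f) ->
  continuous (dissip xs ys).
Proof.
move=> gc p; apply: (@cvgB _ R^o _ (nbhs p)); apply: cvg_dot.
- by apply: (@cvgB _ _ _ (nbhs p)); [exact: cvg_fst|exact: cvg_cst].
- exact: aug_continuous.
- by apply: (@cvgB _ _ _ (nbhs p)); [exact: cvg_snd|exact: cvg_cst].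
- exact: residual_continuous.
Qed.

Lemma lyap_continuous (xs : 'cV[R]_n) ys (p : T) : gamma < 1 ->
  (forall i : 'I_n, bregman_dom (i < s)%N (xs i 0) (p.1 i 0)) ->
  {for p, continuous (lyap xs ys)}.
Proof.
move=> g1 dom; apply: (@cvgD _ R^o _ (nbhs p)).
  apply: cvg_sum => i.
  apply: (@continuous_cvg _ _ _ (nbhs p) _ (fun q : T => q.1 i 0)
    (bregman gamma (i < s)%N (xs i 0)) (p.1 i 0)).
    by apply: bregman_continuous => //; exact: dom.
  by apply: cvg_coord; exact: cvg_fst.
apply: (@cvgZr _ R^o _ (nbhs p)); apply: cvg_dot;
  by apply: (@cvgB _ _ _ (nbhs p)); [exact: cvg_snd|exact: cvg_cst].
Qed.

End lyapunov.

(** * Boundedness and limit points of the ODE trajectory *)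

Section trajectory.
Context {R : realType} {m n s : nat} (le_sn : (s <= n)%N).
Context (f : 'cV[R]_n -> R) (A : 'M[R]_(m, n)) (b : 'cV[R]_m).
Context (gamma t0 sigma1 sigma2 : R).
Context (x : R -> 'cV[R]_n) (y : R -> 'cV[R]_m).
Hypothesis f_convex : convex_function [set: convex_lmodType 'cV[R]_n] f.
Hypothesis f_diff : forall x, differentiable f x.
Hypothesis f_grad : continuous (gradient f).
Hypotheses (gamma_ge : 2^-1 <= gamma) (gamma_lt1 : gamma < 1).
Hypotheses (sigma1_gt0 : 0 < sigma1) (sigma2_gt0 : 0 < sigma2).

Local Notation T := ('cV[R]_n * 'cV[R]_m)%type.
Local Notation z := (aug f A b sigma1).
Local Notation V := (@lyap R m n s gamma sigma2).
Local Notation W := (dissip f A b sigma1).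
Local Notation w := (fun t => (x t, y t) : T).
Local Notation limit p := (cluster (w t @[t --> +oo]) p).

Hypothesis x_pos : forall t (i : 'I_n), t0 < t -> (i < s)%N -> 0 < x t i 0.
Hypothesis x_ode : forall t (i : 'I_n), t0 < t ->
  is_derive t 1 (fun r => x r i 0)
    (- (rate gamma (i < s)%N (x t i 0) * z (w t) i 0)).
Hypothesis y_ode : forall t (j : 'I_m), t0 < t ->
  is_derive t 1 (fun r => y r j 0) (sigma2 * (A *m x t - b) j 0).

(** The scaling [rate] of the flow cancels the denominator in the derivative of the divergence, and
    [sigma2] cancels against the weight of the dual term. *)
Lemma lyap_derive xs ys t : t0 < t ->
  is_derive t 1 (fun r => V xs ys (w r)) (- W xs ys (w t)).
Proof.
move=> t0t; rewrite /lyap /dissip.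
pose hx (i : 'I_n) r := bregman gamma (i < s)%N (xs i 0) (x r i 0).
pose hy (j : 'I_m) r := (y r j 0 - ys j 0) * (y r j 0 - ys j 0).
have -> : (fun r => V xs ys (w r)) = (\sum_i hx i) + (2 * sigma2)^-1 \*: (\sum_j hy j).
  apply/funext => r; rewrite /lyap /= -[RHS]/(_ r + _ * _ r) !fct_sumE.
  by congr (_ + _ * _); apply: eq_bigr => j _; rewrite !mxE.
have dx i : is_derive t 1 (hx i) (- ((x t i 0 - xs i 0) * z (w t) i 0)).
  have xi : (i < s)%N -> 0 < x t i 0 by exact: x_pos.
  have d1 := is_derive_bregman _ gamma_lt1 (i < s)%N (xs i 0) _ xi.
  have r0 := rate_gt0 gamma _ _ xi.
  have -> : - ((x t i 0 - xs i 0) * z (w t) i 0) =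
      (x t i 0 - xs i 0) / rate gamma (i < s)%N (x t i 0) *
      - (rate gamma (i < s)%N (x t i 0) * z (w t) i 0) by field; rewrite gt_eqF.
  exact: (is_derive1_comp d1 (x_ode _ i t0t)).
have dy j : is_derive t 1 (hy j) (2 * sigma2 * ((y t j 0 - ys j 0) * (A *m x t - b) j 0)).
  have dyj := y_ode _ j t0t.
  by apply: is_derive_eq; rewrite /GRing.scale/=; ring.
apply: is_derive_eq.
rewrite /GRing.scale/= -mulr_sumr mulKf ?mulf_neq0 ?gt_eqF// sumrN opprB addrC.
by congr (_ - _); apply: eq_bigr => i _; rewrite !mxE.
Qed.

Section kkt_pair.
Context (xs : 'cV[R]_n) (ys : 'cV[R]_m).
Hypothesis xys : kkt (s := s) f A b xs ys.

Lemma dissip_trajectory_ge0 t : t0 < t -> 0 <= W xs ys (w t).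
Proof.
move=> t0t; have [|??? ] := dissip_ge0 f A b sigma1 xs ys (w t) f_convex f_diff sigma1_gt0 xys.
  by move=> i is_; rewrite ltW// x_pos.
by rewrite dissipE ?addr_ge0//; case: xys => -[].
Qed.

Lemma bregman_dom_kkt t (i : 'I_n) : t0 < t ->
  bregman_dom (i < s)%N (xs i 0) (x t i 0).
Proof.
move=> t0t is_; split => // [||_]; last exact: x_pos.
  by case: xys => -[_ xs0] _; exact: xs0.
by rewrite ltW// x_pos.
Qed.

Lemma lyap_terms t : t0 < t ->
  (forall i : 'I_n, bregman gamma (i < s)%N (xs i 0) (x t i 0) <= V xs ys (w t)) /\
  (2 * sigma2)^-1 * dot (y t - ys) (y t - ys) <= V xs ys (w t).
Proof.
move=> t0t; have b0 (i : 'I_n) : 0 <= bregman gamma (i < s)%N (xs i 0) (x t i 0).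
  by apply: bregman_ge0 => //; exact: bregman_dom_kkt.
have y0 : 0 <= (2 * sigma2)^-1 * dot (y t - ys) (y t - ys).
  by rewrite mulr_ge0 ?dot_ge0// invr_ge0 mulr_ge0// ltW.
split=> [i|]; last by rewrite lerDr sumr_ge0.
by rewrite /lyap (bigD1 i)//= -addrA lerDl addr_ge0// sumr_ge0.
Qed.

(** The differential equations are available as two-sided derivatives for [t > t0] only; starting
    the estimates at [t0 + 1] gives a closed half-line of such times. *)
Lemma lyap_bounded t : t0 + 1 <= t -> V xs ys (w t) <= V xs ys (w (t0 + 1)).
Proof.
move=> t1t; have t0u u : t0 + 1 <= u -> t0 < u by move=> ?; lra.
rewrite -lerN2; apply: (derive_nonneg_le (fun r => - V xs ys (w r)) (fun r => W xs ys (w r))) => //.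
- move=> u /andP[t1u _]; have ? := lyap_derive xs ys _ (t0u _ t1u).
  by apply: is_derive_eq; rewrite opprK.
- by move=> u /andP[t1u _]; apply: dissip_trajectory_ge0; exact: t0u.
Qed.

Lemma lyap_cvg : exists l : R, V xs ys (w t) @[t --> +oo] --> l.
Proof.
have t0u u : t0 + 1 <= u -> t0 < u by move=> ?; lra.
apply: (@nonincreasing_derive_cvg _ _ (fun t => - W xs ys (w t)) (t0 + 1) 0) => t t1t.
- by apply: lyap_derive; exact: t0u.
- by rewrite oppr_le0 dissip_trajectory_ge0// t0u.
- have [_] := lyap_terms _ (t0u _ t1t); apply: le_trans.
  by rewrite mulr_ge0 ?dot_ge0// invr_ge0 mulr_ge0// ltW.
Qed.

Lemma x_away (i : 'I_n) : (i < s)%N -> 0 < xs i 0 ->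
  exists2 d, 0 < d & forall t, t0 + 1 <= t -> d <= x t i 0.
Proof.
move=> is_ xsi; have [d d0 dP] := bregman_away _ gamma_ge gamma_lt1 _ (V xs ys (w (t0 + 1))) xsi.
exists d => // t t1t; have t0t : t0 < t by lra.
apply: dP; first exact: x_pos.
by apply: le_trans (lyap_bounded _ t1t); have [/(_ i)] := lyap_terms _ t0t; rewrite is_.
Qed.

Lemma trajectory_bounded : exists M : R, forall t, t0 + 1 <= t ->
  (forall i, `|x t i 0| <= M) /\ (forall j, `|y t j 0| <= M).
Proof.
pose K := V xs ys (w (t0 + 1)).
have [|i|M1 M1P] := @finite_bound R n (fun i M => forall t, t0 + 1 <= t -> `|x t i 0| <= M).
- by move=> i M M' MM' h t /h /le_trans; exact.
- have [|M MP] := bregman_bounded _ gamma_lt1 (i < s)%N (xs i 0) K.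
    by case: xys => -[_ + _]; exact.
  exists M => t t1t; have t0t : t0 < t by lra.
  apply: MP; first exact: x_pos.
  by apply: le_trans (lyap_bounded _ t1t); have [] := lyap_terms _ t0t.
have [|j|M2 M2P] := @finite_bound R m (fun j M => forall t, t0 + 1 <= t -> `|y t j 0| <= M).
- by move=> i M M' MM' h t /h /le_trans; exact.
- exists (`|ys j 0| + (2 * sigma2 * K + 1)) => t t1t; have t0t : t0 < t by lra.
  have yK : (y t j 0 - ys j 0) ^+ 2 <= 2 * sigma2 * K.
    rewrite -ler_pdivrMl ?mulr_gt0//; have [_] := lyap_terms _ t0t.
    move=> /le_trans/(_ (lyap_bounded _ t1t)); apply: le_trans.
    rewrite ler_pM2l ?invr_gt0 ?mulr_gt0// /dot (bigD1 j)//= !mxE -expr2 lerDl.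
    by apply: sumr_ge0 => k _; rewrite -expr2 sqr_ge0.
  have -> : y t j 0 = ys j 0 + (y t j 0 - ys j 0) by rewrite addrC subrK.
  apply: le_trans (ler_normD _ _) _; rewrite lerD2l.
  have : 0 <= (`|y t j 0 - ys j 0| - 1) ^+ 2 by exact: sqr_ge0.
  have := real_normK (num_real (y t j 0 - ys j 0)).
  have := normr_ge0 (y t j 0 - ys j 0); lra.
exists (Num.max M1 M2) => t t1t; split=> [i|j].
  by rewrite le_max M1P.
by rewrite le_max M2P ?orbT.
Qed.

Definition box (M : R) : set T :=
  [set v : 'cV[R]_n | forall i, `|v i 0| <= M] `*`
  [set v : 'cV[R]_m | forall j, `|v j 0| <= M].

Lemma trajectory_compact :
  exists2 K : set T, compact K & forall t, t0 + 1 <= t -> K (w t).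
Proof.
have [M MP] := trajectory_bounded; exists (box M) => [|t t1t]; last exact: MP.
by apply: compact_setX; exact: compact_box.
Qed.

(** [aug] and the residual are continuous, hence bounded on the compact set containing the
    trajectory, and [rate] is at most [x] below 1 and at most [x ^+ 2] above. *)
Lemma speed_bounded : exists2 L : R, 0 < L & forall t, t0 + 1 <= t ->
  (forall i : 'I_n, `|rate gamma (i < s)%N (x t i 0) * z (w t) i 0| <= L) /\
  (forall j, `|sigma2 * (A *m x t - b) j 0| <= L).
Proof.
have [M MP] := trajectory_bounded; have [K cK wK] := trajectory_compact.
have [Z ZP] := compact_image_bounded _ _ cK (aug_continuous f A b sigma1 f_grad).
have [Q QP] := compact_image_bounded _ _ cK (@residual_continuous _ _ _ A b).
exists (1 + ((1 + M ^+ 2) * `|Z| + sigma2 * `|Q|)) => [|t t1t].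
  by rewrite ltr_pwDl// addr_ge0 ?mulr_ge0 ?addr_ge0 ?sqr_ge0 ?normr_ge0// ltW.
have Ms := sqr_ge0 M; have Z0 := normr_ge0 Z; have Q0 := normr_ge0 Q.
split=> i.
  have xi : (i < s)%N -> 0 < x t i 0 by move=> is_; apply: x_pos => //; lra.
  have r0 := rate_gt0 gamma _ _ xi.
  have rM : rate gamma (i < s)%N (x t i 0) <= 1 + M ^+ 2.
    case: (i < s)%N xi {r0} => [/(_ isT) xi|_]; last by rewrite /rate lerDl.
    have [x1|x1] := leP (x t i 0) 1.
      by apply: le_trans (rate_le_id _ gamma_ge _ xi x1) _; lra.
    apply: le_trans (rate_le_sqr _ gamma_lt1 _ (ltW x1)) _.
    have := (MP _ t1t).1 i; rewrite gtr0_norm// => xM.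
    have : x t i 0 ^+ 2 <= M ^+ 2 by rewrite lerXn2r ?nnegrE//; lra.
    lra.
  rewrite normrM (gtr0_norm r0).
  have : `|z (w t) i 0| <= `|Z| by apply: le_trans (ZP _ _ (wK _ t1t)) (ler_norm _).
  move=> zZ; have := ler_pM (ltW r0) (normr_ge0 _) rM zZ.
  have := mulr_ge0 (ltW sigma2_gt0) Q0; lra.
rewrite normrM gtr0_norm//.
have : `|(A *m x t - b) i 0| <= `|Q| by apply: le_trans (QP _ _ (wK _ t1t)) (ler_norm _).
move=> /(ler_wpM2l (ltW sigma2_gt0)).
have := mulr_ge0 (addr_ge0 ler01 Ms) Z0; lra.
Qed.

Lemma trajectory_slow r : 0 < r -> exists2 d, 0 < d &
  forall t u, t0 + 1 <= t -> t <= u <= t + d -> ball (w t) r (w u).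
Proof.
move=> r0; have [L L0 LP] := speed_bounded.
(* Speed [L] over this time gives a displacement of at most [r / 2], strictly inside the open
   ball. *)
exists (r / (L + L)) => [|t u t1t /andP[tu ud]]; first by rewrite divr_gt0 ?addr_gt0.
have lip (g dg : R -> R) : (forall t, t0 < t -> is_derive t 1 g (dg t)) ->
    (forall t, t0 + 1 <= t -> `|dg t| <= L) -> ball (g t) r (g u).
  move=> gdg dgL; rewrite -ball_normE /ball_/= distrC.
  move: tu; rewrite le_eqVlt => /predU1P[<-|tu]; first by rewrite subrr normr0.
  have [|c /andP[tc cu] ->] := MVT_derive g dg _ _ tu.
    by move=> v /andP[tv _]; apply: gdg; lra.
  rewrite normrM (gtr0_norm (_ : 0 < u - t)) ?subr_gt0//.
  have ut : u - t <= r / (L + L) by lra.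
  have dc : `|dg c| <= L by apply: dgL; lra.
  apply: (@le_lt_trans _ _ (L * (r / (L + L)))).
    by rewrite ler_pM ?normr_ge0// subr_ge0 ltW.
  have -> : L * (r / (L + L)) = r / 2 by field; rewrite gt_eqF ?addr_gt0.
  lra.
split; split => // i j; rewrite ord1 /=.
- apply: (lip (fun r => x r i 0) (fun t => - (rate gamma (i < s)%N (x t i 0) * z (w t) i 0))).
  by move=> v /LP[+ _]; rewrite normrN; exact.
- apply: (lip (fun r => y r i 0) (fun t => sigma2 * (A *m x t - b) i 0)).
  by move=> v /LP[_]; exact.
Qed.

Lemma limit_pos p (i : 'I_n) : limit p -> (i < s)%N -> 0 <= p.1 i 0.
Proof.
move=> lp is_; apply: (@cluster_le _ _ _ p (fun q : T => q.1 i 0) 0 lp).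
  by apply: cvg_coord; exact: cvg_fst.
by exists t0; split; [exact: num_real|move=> t t0t; rewrite ltW// x_pos].
Qed.

(** The lower bound of [x_away] passes to the limit. As [xs] may be any primal solution, limit
    points have the largest support. *)
Lemma limit_support p (i : 'I_n) : limit p -> (i < s)%N -> 0 < xs i 0 -> 0 < p.1 i 0.
Proof.
move=> lp is_ /(x_away _ is_)[d d0 dx]; apply: lt_le_trans d0 _.
apply: (@cluster_le _ _ _ p (fun q : T => q.1 i 0) d lp).
  by apply: cvg_coord; exact: cvg_fst.
by exists (t0 + 1); split; [exact: num_real|move=> t /ltW /dx].
Qed.

Lemma limit_dom p : limit p ->
  forall i : 'I_n, bregman_dom (i < s)%N (xs i 0) (p.1 i 0).
Proof.
move=> lp i is_; split; [|exact: limit_pos|exact: limit_support].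
by case: xys => -[_ xs0] _; exact: xs0.
Qed.

Lemma limit_lyap p q : limit p -> limit q -> V xs ys p = V xs ys q.
Proof.
move=> lp lq; have [l Vl] := lyap_cvg.
have Vlim p' : limit p' -> V xs ys p' = l.
  move=> lp'; apply: (@cluster_lim _ _ _ p' (V xs ys) l lp' _ Vl).
  by apply: lyap_continuous => //; exact: limit_dom.
by rewrite !Vlim.
Qed.

(** Barbalat's argument makes the dissipation vanish at [p], hence each of its three terms. The
    second gives [A *m p.1 = b]; the third and the first then give
    [dot (gradient f p.1) (p.1 - xs) = 0], and the gradient inequality at [p.1] yields
    [f p.1 <= f xs]. *)
Lemma limit_optimal p : limit p -> primal_optimal s f A b p.1.
Proof.
move=> lp; have [l Vl] := lyap_cvg.
have W0 : - W xs ys p = 0.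
  apply: (@cluster_derive_eq0 _ T w (fun t => V xs ys (w t))
    (fun q => - W xs ys q) p (t0 + 1) l) => //.
  - exact: trajectory_slow.
  - by move=> t t1t; apply: lyap_derive; lra.
  - by apply: (@cvgN _ R^o _ (nbhs p)); exact: dissip_continuous.
have p0 (i : 'I_n) : (i < s)%N -> 0 <= p.1 i 0 by exact: limit_pos.
have [[Axs xs0] _] := xys.
have [g0 a0 z0] := dissip_ge0 f A b sigma1 xs ys p f_convex f_diff sigma1_gt0 xys p0.
move/eqP: W0; rewrite oppr_eq0 dissipE// => /eqP W0.
have Ap : A *m p.1 = b.
  apply/eqP; rewrite -subr_eq0; apply/eqP/dot_eq0.
  have : sigma1 * dot (A *m p.1 - b) (A *m p.1 - b) = 0 by lra.
  by move/eqP; rewrite mulf_eq0 gt_eqF//= => /eqP.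
split; first by split.
move=> x' x'f; have [_ xs_min] := kkt_primal_optimal le_sn f A b f_convex f_diff _ _ xys.
apply: le_trans (xs_min _ x'f).
have := convex_gradient_le f p.1 xs f_convex (f_diff _).
have : dot (gradient f xs) (p.1 - xs) = 0.
  have : dot (p.1 - xs) (kkt_gradient f A xs ys) = 0 by lra.
  by rewrite /kkt_gradient dotDr -dot_mulmx mulmxBr Ap Axs subrr dot0l addr0 dotC.
have : dot (gradient f p.1 - gradient f xs) (p.1 - xs) = 0 by lra.
rewrite dotBl -[xs - p.1]opprB dotNr; lra.
Qed.

End kkt_pair.

Lemma limit_unique xs ys p q : kkt (s := s) f A b xs ys -> limit p -> limit q ->
  p.1 = q.1 /\ dot (p.2 - ys) (p.2 - ys) = dot (q.2 - ys) (q.2 - ys).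
Proof.
move=> xys lp lq.
have kkt_lim p' : limit p' -> kkt (s := s) f A b p'.1 ys.
  move=> lp'; have p'opt := limit_optimal _ _ xys _ lp'.
  have [y' p'y'] := primal_optimal_kkt f A b f_diff _ p'opt.
  exact: (kkt_exchange le_sn f A b f_convex f_diff _ _ _ _ p'y' xys).
have s2 : 0 < (2 * sigma2)^-1 by rewrite invr_gt0 mulr_gt0.
(* The Lyapunov function centred at [p'.1] takes the same value at [q'] and at [p'], where its
   divergence part is zero. Adding this for [(p, q)] and [(q, p)] makes two nonnegative sums of
   divergences add up to 0. *)
have key p' q' : limit p' -> limit q' ->
    \sum_(i < n) bregman gamma (i < s)%N (p'.1 i 0) (q'.1 i 0) +
    (2 * sigma2)^-1 * dot (q'.2 - ys) (q'.2 - ys)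
    = (2 * sigma2)^-1 * dot (p'.2 - ys) (p'.2 - ys).
  move=> lp' lq'; have := limit_lyap _ _ (kkt_lim _ lp') _ _ lq' lp'.
  by rewrite /lyap => ->; rewrite big1 ?add0r// => i _; rewrite bregman_self.
have dom p' q' (i : 'I_n) : limit p' -> limit q' ->
    bregman_dom (i < s)%N (p'.1 i 0) (q'.1 i 0).
  by move=> lp' lq'; exact: (limit_dom _ _ (kkt_lim _ lp')).
have ge0 p' q' : limit p' -> limit q' ->
    0 <= \sum_(i < n) bregman gamma (i < s)%N (p'.1 i 0) (q'.1 i 0).
  by move=> lp' lq'; apply: sumr_ge0 => i _; apply: bregman_ge0 => //; exact: dom.
have kpq := key _ _ lp lq; have kqp := key _ _ lq lp.
have gpq := ge0 _ _ lp lq; have gqp := ge0 _ _ lq lp.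
split; last first.
  by apply: (mulfI (lt0r_neq0 s2)); lra.
have /eqP : \sum_(i < n) bregman gamma (i < s)%N (p.1 i 0) (q.1 i 0) = 0 by lra.
rewrite psumr_eq0 => [/allP pq0|i _]; last by apply: bregman_ge0 => //; exact: dom.
apply/colP => i; apply/esym/(bregman_eq0 gamma gamma_lt1 _ _ _ (dom _ _ i lp lq)).
by apply/eqP/pq0; rewrite mem_index_enum.
Qed.

Lemma near_start (P : R -> Prop) : (forall t, t0 + 1 <= t -> P t) ->
  \forall t \near +oo, P t.
Proof.
by move=> tP; exists (t0 + 1); split; [exact: num_real|move=> t /ltW /tP].
Qed.

Lemma limit_exists xs ys : kkt (s := s) f A b xs ys -> exists p : T, limit p.
Proof.
move=> xys; have [K cK wK] := trajectory_compact _ _ xys.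
exact: (compact_cluster_ex w K cK (near_start _ wK)).
Qed.

Lemma x_cvg xs ys (p : T) : kkt (s := s) f A b xs ys -> limit p ->
  x t @[t --> +oo] --> p.1.
Proof.
move=> xys lp; have [K cK wK] := trajectory_compact _ _ xys.
apply: (@compact_cluster_cvg _ _ w _ K fst p.1 cK (near_start _ wK)).
  by move=> q; exact: cvg_fst.
by move=> q lq; have [] := limit_unique _ _ _ _ xys lq lp.
Qed.

Lemma aug_limit xs ys (p : T) : kkt (s := s) f A b xs ys -> limit p ->
  z p = kkt_gradient f A p.1 p.2.
Proof.
move=> xys lp; have [[Ap _] _] := limit_optimal _ _ xys _ lp.
by rewrite /aug /aug_gradient Ap subrr mulmx0 scaler0 addr0.
Qed.

(** Barbalat's argument applies to [h (x t i 0)] with [h] an antiderivative of the inverse of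
    [rate]: its derivative along the flow is exactly [- z], and it converges because the limit
    coordinate lies where [h] is continuous. *)
Lemma limit_stationary xs ys (p : T) (i : 'I_n) : kkt (s := s) f A b xs ys ->
  limit p -> ((i < s)%N -> 0 < p.1 i 0) -> z p i 0 = 0.
Proof.
move=> xys lp pi0; apply/oppr_inj; rewrite oppr0.
have xi : x t i 0 @[t --> +oo] --> p.1 i 0.
  by apply: cvg_coord; exact: x_cvg xys lp.
pose h := if (i < s)%N then prim0 gamma else id.
have dh (u : R) : ((i < s)%N -> 0 < u) -> is_derive u 1 h (rate gamma (i < s)%N u)^-1.
  rewrite /h; case: (i < s)%N => [/(_ isT) u0|_]; first exact: is_derive_prim0.
  by rewrite /rate invr1; exact: is_derive_id.
apply: (@cluster_derive_eq0 _ T w (fun t => h (x t i 0)) (fun q => - z q i 0) p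
  (t0 + 1) (h (p.1 i 0))) => //.
- exact: trajectory_slow xys.
- move=> t t1t; have t0t : t0 < t by lra.
  have xti : (i < s)%N -> 0 < x t i 0 by exact: x_pos.
  have r0 := rate_gt0 gamma _ _ xti.
  have -> : - z (w t) i 0 = (rate gamma (i < s)%N (x t i 0))^-1 *
      - (rate gamma (i < s)%N (x t i 0) * z (w t) i 0) by field; rewrite gt_eqF.
  exact: (is_derive1_comp (dh _ xti) (x_ode _ i t0t)).
- apply: (@continuous_cvg _ _ _ _ _ (fun t => x t i 0) h (p.1 i 0)) => //.
  by have [dhp _] := dh _ pi0; apply/differentiable_continuous/derivable1_diffP.
- by apply: (@cvgN _ R^o _ (nbhs p)); apply: cvg_coord; exact: aug_continuous.
Qed.

(** * Dual convergence under strict complementarity *)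

Section strict_complementarity.
Context (xh : 'cV[R]_n) (yh : 'cV[R]_m).
Hypothesis xyh : kkt (s := s) f A b xh yh.
Hypothesis strict : forall i : 'I_n, (i < s)%N ->
  0 < xh i 0 + kkt_gradient f A xh yh i 0.

(** With [yh] fixed, the multiplier is the same at [p.1] as at [xh]. By [limit_support],
    [p.1 i 0 = 0] forces [xh i 0 = 0], and strict complementarity makes the multiplier positive. *)
Lemma limit_gradient_gt0 (p : T) (i : 'I_n) : limit p -> (i < s)%N ->
  p.1 i 0 = 0 -> 0 < kkt_gradient f A p.1 yh i 0.
Proof.
move=> lp is_ pi0; have popt := limit_optimal _ _ xyh _ lp.
have [_ /=] := dual_optimal_kkt le_sn f A b f_convex f_diff _ _ popt
  (kkt_dual_optimal le_sn f A b f_convex f_diff _ _ xyh).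
move=> /colP/(_ (Ordinal is_)); rewrite [LHS]mxE [RHS]mxE.
rewrite (_ : widen_ord le_sn _ = i); last exact: val_inj.
move=> <-; have xhi : xh i 0 = 0.
  apply/eqP; rewrite eq_le xyh.1.2// andbT leNgt; apply/negP.
  by move=> /(limit_support _ _ xyh _ _ lp is_); rewrite pi0 ltxx.
by have := strict _ is_; rewrite xhi add0r.
Qed.

(** Both [z p] and [z q] vanish at [i]; since [p.1 = q.1], their difference is the entry of
    [A^T *m (p.2 - q.2)]. *)
Lemma limit_tangent (p q : T) (i : 'I_n) : limit p -> limit q ->
  ((i < s)%N -> 0 < p.1 i 0) -> (A^T *m (p.2 - q.2)) i 0 = 0.
Proof.
move=> lp lq pi0; have [pq _] := limit_unique _ _ _ _ xyh lp lq.
have zp := limit_stationary _ _ _ _ xyh lp pi0.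
have zq : z q i 0 = 0 by apply: limit_stationary xyh lq _; rewrite -pq.
move: zp zq; rewrite !(aug_limit _ _ _ xyh)// -pq /kkt_gradient.
have addE (u v : 'cV[R]_n) : (u + v) i 0 = u i 0 + v i 0 by rewrite mxE.
have oppE (u : 'cV[R]_n) : (- u) i 0 = - u i 0 by rewrite mxE.
rewrite mulmxBr !addE oppE; lra.
Qed.

(* Strict complementarity puts [yh] in the relative interior of the dual
   optimal face, so that it can be moved a little towards [p.2 - q.2]. *)
Lemma kkt_perturb (p q : T) : limit p -> limit q ->
  exists2 e, 0 < e & kkt (s := s) f A b p.1 (yh + e *: (p.2 - q.2)).
Proof.
move=> lp lq; have popt := limit_optimal _ _ xyh _ lp.
have [pyh _] := dual_optimal_kkt le_sn f A b f_convex f_diff _ _ popt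
  (kkt_dual_optimal le_sn f A b f_convex f_diff _ _ xyh).
pose a := A^T *m (p.2 - q.2).
pose G := kkt_gradient f A p.1 yh.
have [i M M' MM' MP|i|M MP] := @finite_bound R n (fun i M =>
    (i < s)%N -> p.1 i 0 = 0 -> `|a i 0| <= M * G i 0).
- move=> is_ pi0; apply: le_trans (MP is_ pi0) _.
  by rewrite ler_wpM2r// ltW// limit_gradient_gt0.
- exists (`|a i 0| / G i 0) => is_ pi0.
  by rewrite divfK// gt_eqF// limit_gradient_gt0.
have M0 : 0 < `|M| + 1 by rewrite ltr_wpDl.
(* On active coordinates [|a i 0| <= M * G i 0], so a step of this length keeps [G i 0 + e * a i 0]
   nonnegative. *)
exists (`|M| + 1)^-1; first by rewrite invr_gt0.
split=> [|i]; first exact: popt.1.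
have GE : kkt_gradient f A p.1 (yh + (`|M| + 1)^-1 *: (p.2 - q.2)) i 0 =
    G i 0 + (`|M| + 1)^-1 * a i 0.
  rewrite /kkt_gradient mulmxDr -scalemxAr addrA -/G -/a [LHS]mxE.
  by congr (_ + _); rewrite [LHS]mxE.
have := pyh.2 i; rewrite GE -/G; case: ifPn => [is_ [G0 pG]|is_ G0]; last first.
  by rewrite G0 add0r (limit_tangent _ _ _ lp lq) ?mulr0// (negbTE is_).
have [pi0|] := eqVneq (p.1 i 0) 0; last first.
  move=> pi_neq0; have pi0 : 0 < p.1 i 0.
    by rewrite lt_neqAle eq_sym pi_neq0 limit_pos.
  by rewrite (limit_tangent _ _ _ lp lq)// mulr0 addr0 G0.
split; last by rewrite pi0 mul0r.
have aG := MP i is_ pi0.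
rewrite -(pmulr_rge0 _ M0) mulrDr mulVKf ?gt_eqF//.
have : M * G i 0 <= `|M| * G i 0 by rewrite ler_wpM2r ?ler_norm.
have : - a i 0 <= `|a i 0| by rewrite -normrN ler_norm.
move: aG; lra.
Qed.

Lemma limit_dual_unique (p q : T) : limit p -> limit q -> p = q.
Proof.
move=> lp lq; have [pq1 pq2] := limit_unique _ _ _ _ xyh lp lq.
have [e e0 kkte] := kkt_perturb _ _ lp lq.
have [_] := limit_unique _ _ _ _ kkte lp lq; rewrite !opprD !addrA => pq3.
have v0 : p.2 - q.2 = 0.
  apply: (equidistant_eq0 _ _ _ _ e0 _ pq2 pq3).
  by rewrite opprB addrA subrK.
move/eqP: v0; rewrite subr_eq0 => /eqP pq2'.
by rewrite [p]surjective_pairing [q]surjective_pairing pq1 pq2'.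
Qed.

Lemma trajectory_cvg (p : T) : limit p -> w t @[t --> +oo] --> p.
Proof.
move=> lp; have [K cK wK] := trajectory_compact _ _ xyh.
apply: (@compact_cluster_cvg _ _ w _ K id p cK (near_start _ wK)).
  by move=> q; exact: cvg_id.
by move=> q lq; exact: limit_dual_unique.
Qed.

(** The remaining point is the sign of [z p i 0] when [p.1 i 0 = 0]. If it were negative,
    convergence of the whole trajectory would make [z] negative at all late times, so that the
    positive coordinate [x t i 0] would be nondecreasing and could not tend to 0. *)
Lemma limit_kkt (p : T) : limit p -> kkt (s := s) f A b p.1 p.2.
Proof.
move=> lp; have popt := limit_optimal _ _ xyh _ lp; split=> [|i]; first exact: popt.1.
rewrite -(aug_limit _ _ _ xyh lp).
case: ifPn => is_; last by apply: (limit_stationary _ _ _ _ xyh lp); rewrite (negbTE is_).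
have [pi0|pi_neq0] := eqVneq (p.1 i 0) 0; last first.
  rewrite (limit_stationary _ _ _ _ xyh lp) ?mulr0// => _.
  by rewrite lt_neqAle eq_sym pi_neq0 limit_pos.
split; last by rewrite pi0 mul0r.
rewrite leNgt; apply/negP => zi0.
have zt : z (w t) i 0 @[t --> +oo] --> z p i 0.
  apply: cvg_coord; apply: (@continuous_cvg _ _ _ _ _ w z p); last exact: trajectory_cvg.
  exact: aug_continuous.
have /cvgrPdist_lt /(_ (- z p i 0)) := zt; rewrite oppr_gt0 => /(_ zi0) [t1 [_ zt0]].
have /andP[t01 t11] : (t0 < Num.max t0 t1 + 1) && (t1 < Num.max t0 t1 + 1).
  by rewrite !ltr_pwDr ?le_max ?lexx ?orbT.
set t2 := Num.max t0 t1 + 1 in t01 t11.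
have : x t2 i 0 <= p.1 i 0.
  have xi : x t i 0 @[t --> +oo] --> p.1 i 0 by apply: cvg_coord; exact: x_cvg xyh lp.
  rewrite -(cvg_lim _ xi)//; apply: limr_ge; first by apply/cvg_ex; exists (p.1 i 0).
  exists t2; split=> [|t t2t]; first exact: num_real.
  apply: (derive_nonneg_le (fun r => x r i 0)
    (fun r => - (rate gamma (i < s)%N (x r i 0) * z (w r) i 0))); first exact: ltW.
    by move=> u /andP[t2u _]; apply: x_ode; exact: lt_le_trans t2u.
  move=> u /andP[t2u _]; have := zt0 u (lt_le_trans t11 t2u).
  move=> /ltr_normlP[zu _]; rewrite oppr_ge0 mulr_ge0_le0//; last by lra.
  by rewrite ltW// rate_gt0// => _; rewrite x_pos// (lt_le_trans t01).
by rewrite pi0 leNgt x_pos.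
Qed.

End strict_complementarity.

(** * The three conclusions for the trajectory *)

Lemma limit_set_cluster (p : T) : limit_set t0 x y p -> limit p.
Proof. by case=> t_ [_ t_oo wp]; exact: sequence_cluster t_oo wp. Qed.

Lemma limit_dual_equidistant (p1 p2 : T) d : primal_optimal s f A b !=set0 ->
  limit_set t0 x y p1 -> limit_set t0 x y p2 -> dual_optimal le_sn f A b d ->
  euclidean_norm (p1.2 - d.1) = euclidean_norm (p2.2 - d.1).
Proof.
move=> [xs xs_opt] /limit_set_cluster lp1 /limit_set_cluster lp2 dopt.
have [xsd _] := dual_optimal_kkt le_sn f A b f_convex f_diff _ _ xs_opt dopt.
by rewrite !euclidean_norm_dot; have [_ ->] := limit_unique _ _ _ _ xsd lp1 lp2.
Qed.

Lemma primal_cvg : primal_optimal s f A b !=set0 ->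
  exists xs : 'cV[R]_n,
    [/\ x t @[t --> +oo] --> xs, primal_optimal s f A b xs
      & forall x', primal_optimal s f A b x' ->
          (num_positive s x' <= num_positive s xs)%N].
Proof.
move=> [xs xs_opt]; have [ys xys] := primal_optimal_kkt f A b f_diff _ xs_opt.
have [p lp] := limit_exists _ _ xys.
exists p.1; split; [exact: x_cvg xys lp|exact: limit_optimal xys _ lp|].
move=> x' x'_opt; have [y' x'y'] := primal_optimal_kkt f A b f_diff _ x'_opt.
(* The count is compared through inclusion: the support of every primal solution lies in that of the
   limit. *)
apply/subset_leq_card/fintype.subsetP => i; rewrite !inE => /andP[is_ x'i].
by rewrite is_ (limit_support _ _ x'y').
Qed.

Lemma dual_cvg (xh : 'cV[R]_n) (d : 'cV[R]_m * 'cV[R]_s) :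
  primal_optimal s f A b xh -> dual_optimal le_sn f A b d ->
  strictly_complementary le_sn xh d.2 ->
  exists d' : 'cV[R]_m * 'cV[R]_s, dual_optimal le_sn f A b d' /\
    (y t, rowsub (widen_ord le_sn) (z (w t))) @[t --> +oo] --> d'.
Proof.
move=> xh_opt d_opt sc.
have [xyh zhE] := dual_optimal_kkt le_sn f A b f_convex f_diff _ _ xh_opt d_opt.
have strict (i : 'I_n) : (i < s)%N -> 0 < xh i 0 + kkt_gradient f A xh d.1 i 0.
  move=> is_; have [_] := sc (Ordinal is_); rewrite zhE [rowsub _ _ _ _]mxE.
  by rewrite (_ : widen_ord le_sn _ = i)//; exact: val_inj.
have [p lp] := limit_exists _ _ xyh.
(* At the limit the residual is zero, so the limit of the augmented gradient is [kkt_gradient], the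
   multiplier belonging to [p.2]. *)
exists (p.2, rowsub (widen_ord le_sn) (kkt_gradient f A p.1 p.2)); split.
  by apply: kkt_dual_optimal => //; exact: limit_kkt xyh strict _ lp.
have wp := trajectory_cvg _ _ xyh strict _ lp.
have zp : z (w t) @[t --> +oo] --> z p.
  apply: (@continuous_cvg _ _ _ _ _ w z p _ wp); exact: aug_continuous.
have yp : y t @[t --> +oo] --> p.2.
  exact: (@continuous_cvg _ _ _ _ _ w snd p (@cvg_snd _ _ _ _ _) wp).
have rp : rowsub (widen_ord le_sn) (z (w t)) @[t --> +oo] -->
    rowsub (widen_ord le_sn) (kkt_gradient f A p.1 p.2); last exact: (cvg_pair yp rp).
apply: cvg_mx_coord => i j; rewrite ord1 [rowsub _ _ _ _]mxE.
rewrite (_ : (fun t => _) = (fun t => z (w t) (widen_ord le_sn i) 0)).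
  by rewrite -(aug_limit _ _ _ xyh lp); exact: cvg_coord.
by apply/funext => t; rewrite mxE.
Qed.

End trajectory.

Theorem theorem4p3 (R : realType) (m n s : nat) (le_sn : (s <= n)%N)
    (f : 'cV[R]_n -> R) (A : 'M[R]_(m, n)) (b : 'cV[R]_m)
    (gamma t0 sigma1 sigma2 : R) (x0 : 'cV[R]_n) (y0 : 'cV[R]_m)
    (x : R -> 'cV[R]_n) (y : R -> 'cV[R]_m)
    (f_convex : convex_function [set: convex_lmodType 'cV[R]_n] f)
    (f_C2 : twice_continuously_differentiable f)
    (A_rank : \rank A = m)
    (gamma_ge : 2^-1 <= gamma) (gamma_lt1 : gamma < 1)
    (t0_ge0 : 0 <= t0) (sigma1_gt0 : 0 < sigma1) (sigma2_gt0 : 0 < sigma2)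
    (primal_solvable : primal_optimal s f A b !=set0)
    (x0_pos : pos_orthant R n s x0)
    (xy_sol : ode_solution s f A b gamma t0 sigma1 sigma2 x0 y0 x y) :
  [/\ (* (a) *)
      forall p1 p2 d, limit_set t0 x y p1 -> limit_set t0 x y p2 ->
        dual_optimal le_sn f A b d ->
        euclidean_norm (p1.2 - d.1) = euclidean_norm (p2.2 - d.1),
      (* (b) *)
      exists xs : 'cV[R]_n,
        [/\ x t @[t --> +oo] --> xs,
            primal_optimal s f A b xs
          & forall x', primal_optimal s f A b x' ->
              (num_positive s x' <= num_positive s xs)%N]
    & (* (c) *)
      (exists (xs : 'cV[R]_n) (d : 'cV[R]_m * 'cV[R]_s),
        [/\ primal_optimal s f A b xs, dual_optimal le_sn f A b d
          & strictly_complementary le_sn xs d.2]) ->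
      exists d : 'cV[R]_m * 'cV[R]_s,
        dual_optimal le_sn f A b d /\
        (y t, rowsub (widen_ord le_sn)
                (aug_gradient f A b sigma1 (x t) (y t))) @[t --> +oo] --> d].
Proof.
case: xy_sol => _ _ sol; case: f_C2 => f_diff grad_diff _.
have f_grad : continuous (gradient f).
  by move=> v; exact: differentiable_continuous (grad_diff v).
have x_pos t (i : 'I_n) : t0 < t -> (i < s)%N -> 0 < x t i 0.
  by move=> /ltW /sol[+ _ _]; exact.
have x_ode t (i : 'I_n) : t0 < t -> is_derive t 1 (fun r => x r i 0)
    (- (rate gamma (i < s)%N (x t i 0) * aug f A b sigma1 (x t, y t) i 0)).
  move=> t0t; have [_ xt _] := sol t (ltW t0t).
  have := is_derivative_in_coord _ _ _ _ _ i t0t xt.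
  by rewrite mxE scaling_mx_sqrE.
have y_ode t (j : 'I_m) : t0 < t ->
    is_derive t 1 (fun r => y r j 0) (sigma2 * (A *m x t - b) j 0).
  move=> t0t; have [_ _ yt] := sol t (ltW t0t).
  have := is_derivative_in_coord _ _ _ _ _ j t0t yt.
  by rewrite mxE.
split.
- move=> p1 p2 d; exact: (limit_dual_equidistant le_sn f A b gamma t0 sigma1 sigma2).
- exact: (primal_cvg le_sn f A b gamma t0 sigma1 sigma2 x y).
- move=> [xs [d [xs_opt d_opt sc]]].
  exact: (dual_cvg le_sn f A b gamma t0 sigma1 sigma2 x y _ _ _ _ _ _ _ _ _ _ xs d).
Qed.
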